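(* Let $n\ge 1$ and let $X=X_1\times X_2\times\cdots\times X_n$ be the $n$-fold product of connected graphs $X_i$, each with first Betti number $2$. Then $X$ does not immerse up to homotopy into $\mathbb{R}^{2n-1}$; that is, there is no simplicial complex $Y$ homotopy equivalent to $X$ that immerses in $\mathbb{R}^{2n-1}$.
   Context: A complex $X$ immerses up to homotopy into $\mathbb{R}^k$ if $X$ is homotopy equivalent to some complex $Y$ that immerses in $\mathbb{R}^k$. An immersion of a (locally finite) simplicial complex $Y$ into $\mathbb{R}^k$ is a locally injective piecewise linear map $Y\to\mathbb{R}^k$ (so that $Y$ has an immersed regular neighborhood in $\mathbb{R}^k$). *)

(* Defs.v *)
From HB Require Import structures.
From mathcomp Require Import all_boot all_order all_algebra finmap.
From mathcomp Require Import all_classical all_reals.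
From mathcomp Require Import topology normedtype.

Set Implicit Arguments.
Unset Strict Implicit.
Unset Printing Implicit Defensive.

Import Order.TTheory GRing.Theory Num.Theory.
Import numFieldNormedType.Exports.

Local Open Scope classical_set_scope.
Local Open Scope ring_scope.

Definition homeomorphism (T U : topologicalType) (h : T -> U) : Prop :=
  continuous h /\
  exists g : U -> T, [/\ continuous g, cancel h g & cancel g h].

Definition homotopic (R : realType) (T U : topologicalType) (f g : T -> U)
    : Prop :=
  exists H : T * R -> U,
    [/\ {within [set: T] `*` [set t : R | 0 <= t <= 1], continuous H},
        forall x, H (x, 0) = f x
      & forall x, H (x, 1) = g x].

Definition homotopy_equivalent (R : realType) (T U : topologicalType) : Prop :=
  exists (f : T -> U) (g : U -> T),
    [/\ continuous f, continuous g,
        homotopic R (g \o f) idfun & homotopic R (f \o g) idfun].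

(* Graphs in the topological sense, i.e. one-dimensional CW complexes: loops,
   multiple edges and infinitely many cells are allowed.  The orientation of
   the edges is auxiliary. *)
Record graph := Graph {
  gvertex : choiceType;
  gedge : choiceType;
  gsrc : gedge -> gvertex;
  gtgt : gedge -> gvertex
}.

Section GraphSpace.
Variables (R : realType) (G : graph).

Definition graph_space : Type :=
  (gvertex G + gedge G * {t : R | 0 < t < 1})%type.

HB.instance Definition _ := Choice.on graph_space.

(* The characteristic map of the closed edge e, extended from [0, 1] to R by
   constants; since R retracts onto [0, 1], a set has open preimage in [0, 1]
   if and only if it has open preimage in R. *)
Definition edge_map (e : gedge G) (t : R) : graph_space :=
  match insub t : option {t : R | 0 < t < 1} with
  | Some u => inr (e, u)
  | None => inl (if t <= 0 then gsrc e else gtgt e)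
  end.

Definition graph_open (U : set graph_space) : Prop :=
  forall e, open (edge_map e @^-1` U).

Lemma graph_openT : graph_open [set: graph_space].
Proof. by move=> e; rewrite preimage_setT; exact: openT. Qed.

Lemma graph_openI : setI_closed graph_open.
Proof. by move=> A B oA oB e; apply: openI; [exact: oA | exact: oB]. Qed.

Lemma graph_open_bigU (I : Type) (f : I -> set graph_space) :
  (forall i, graph_open (f i)) -> graph_open (\bigcup_i f i).
Proof.
by move=> of_ e; rewrite preimage_bigcup; apply: bigcup_open => i _; exact: of_.
Qed.

HB.instance Definition _ :=
  isOpenTopological.Build graph_space graph_openT graph_openI graph_open_bigU.

End GraphSpace.

Section GraphHomology.
Variable G : graph.

Definition graph_chain := {fsfun gedge G -> rat with 0}.

Definition graph_boundary (c : graph_chain) (v : gvertex G) : rat :=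
  \sum_(e <- finsupp c) c e * ((gtgt e == v)%:R - (gsrc e == v)%:R).

Definition graph_cycle (c : graph_chain) : Prop :=
  forall v, graph_boundary c v = 0.

(* A graph has no 2-cells, so H_1(G; Q) is the space of 1-cycles; the first
   Betti number is b when this space has a basis with b elements. *)
Definition first_betti_number_is (b : nat) : Prop :=
  exists z : 'I_b -> graph_chain,
    (forall i, graph_cycle (z i)) /\
    forall c, graph_cycle c ->
      exists! a : {ffun 'I_b -> rat}, forall e, c e = \sum_i a i * z i e.

End GraphHomology.

Record simplicial_complex := SimplicialComplex {
  vertex : choiceType;
  simplices : set {fset vertex};
  simplices_neq0 : forall s, simplices s -> s != fset0;
  simplices1 : forall v, simplices [fset v]%fset;
  simplices_sub : forall s t, simplices s -> (t `<=` s)%fset -> t != fset0 ->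
    simplices t
}.

Definition locally_finite (K : simplicial_complex) : Prop :=
  forall v : vertex K, finite_set [set s | simplices s /\ v \in s].

Section Realization.
Variables (R : realType) (K : simplicial_complex).

Definition barycentric (x : {fsfun vertex K -> R with 0}) : bool :=
  [&& finsupp x \in @simplices K, all (fun v => 0 <= x v) (finsupp x)
    & \sum_(v <- finsupp x) x v == 1].

Definition realization : Type :=
  {x : {fsfun vertex K -> R with 0} | barycentric x}.

HB.instance Definition _ := Choice.on realization.

Definition coord (x : realization) : {fsfun vertex K -> R with 0} := val x.

Definition coords (x : realization) : {ptws vertex K -> R} :=
  fun v => coord x v.

Definition closed_simplex (s : {fset vertex K}) : set realization :=
  [set x | (finsupp (coord x) `<=` s)%fset].

(* The coherent (weak) topology: a set is open when its trace on each closed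
   simplex is open for the Euclidean topology of that simplex.  On points
   supported in the finite set s, the product topology is the Euclidean one. *)
Definition realization_open (U : set realization) : Prop :=
  forall s, simplices s ->
    exists2 O : set {ptws vertex K -> R}, open O
      & closed_simplex s `&` coords @^-1` O = closed_simplex s `&` U.

Lemma realization_openT : realization_open [set: realization].
Proof. by move=> s _; exists setT; [exact: openT | rewrite preimage_setT]. Qed.

Lemma realization_openI : setI_closed realization_open.
Proof.
move=> A B oA oB s Ks.
have [P oP eP] := oA s Ks; have [Q oQ eQ] := oB s Ks.
exists (P `&` Q); first exact: openI.
by rewrite preimage_setI setIIr eP eQ -setIIr.
Qed.

Lemma realization_open_bigU (I : Type) (f : I -> set realization) :
  (forall i, realization_open (f i)) -> realization_open (\bigcup_i f i).
Proof.
move=> of_ s Ks.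
have /choice[O OP] : forall i, exists O : set {ptws vertex K -> R},
    open O /\ closed_simplex s `&` coords @^-1` O = closed_simplex s `&` f i.
  by move=> i; have [P oP eP] := of_ i s Ks; exists P.
exists (\bigcup_i O i); first by apply: bigcup_open => i _; have [] := OP i.
rewrite preimage_bigcup !setI_bigcupr; apply: eq_bigcupr => i _.
by have [] := OP i.
Qed.

HB.instance Definition _ := isOpenTopological.Build realization
  realization_openT realization_openI realization_open_bigU.

End Realization.

(* K' is a subdivision of K: its vertices v are the points phi v of |K|, each
   of its simplices lies in a closed simplex of K, and the induced affine map
   h : |K'| -> |K| is a homeomorphism. *)
Definition subdivision (R : realType) (K K' : simplicial_complex)
    (phi : vertex K' -> realization R K)
    (h : realization R K' -> realization R K) : Prop :=
  [/\ forall s', simplices s' -> exists2 s, simplices s &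
        forall v, v \in s' -> closed_simplex s (phi v),
      forall (x : realization R K') (w : vertex K),
        coord (h x) w =
          \sum_(v <- finsupp (coord x)) coord x v * coord (phi v) w
    & homeomorphism h].

(* Piecewise linear: affine on each simplex of some subdivision.  Continuity
   is then automatic. *)
Definition piecewise_linear (R : realType) (K : simplicial_complex) (k : nat)
    (f : realization R K -> 'rV[R]_k) : Prop :=
  exists (K' : simplicial_complex) (phi : vertex K' -> realization R K)
         (h : realization R K' -> realization R K),
    subdivision phi h /\
    forall x : realization R K',
      f (h x) = \sum_(v <- finsupp (coord x)) coord x v *: f (phi v).

Definition locally_injective (T : topologicalType) (U : Type) (f : T -> U)
    : Prop :=
  forall x : T, exists2 A : set T, nbhs x A & set_inj A f.

Definition immersion (R : realType) (K : simplicial_complex) (k : nat)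
    (f : realization R K -> 'rV[R]_k) : Prop :=
  piecewise_linear f /\ locally_injective f.

Definition immerses (R : realType) (K : simplicial_complex) (k : nat) : Prop :=
  locally_finite K /\ exists f : realization R K -> 'rV[R]_k, immersion f.

Definition immerses_up_to_homotopy (R : realType) (X : topologicalType)
    (k : nat) : Prop :=
  exists Y : simplicial_complex,
    homotopy_equivalent R X (realization R Y) /\ immerses R Y k.

(* Main.v *)
(* Fold the plane onto a tripod so that opposite points never lie on the same
   leg, and wrap the three legs around loops of a graph with first Betti number
   at least 2.  The product of n such maps is c : R^(2n) -> X.  If p : X -> Y is
   a homotopy equivalence with inverse q and f : Y -> R^(2n-1) is an immersion,
   then F z = f (p (c z)) - f (p (c (- z))) is odd.  The two independent loops
   give R/Z-valued functions on each graph; lifting them to R along the homotopy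
   from q p to the identity, let A be the set of zeros z of F at which p (c z) =
   p (c (- z)) and the lifts at z and - z agree.  It contains 0, it is bounded
   because c z and c (- z) run along different legs, and by local injectivity of
   f it is open in the zero set of F.

   This contradicts a Borsuk-Ulam theorem.  Take a fine triangulation of R^(2n)
   invariant under z |-> - z, let a_i be the sign of F_i on its vertices
   (0 < i < 2n), and let a_0 be another odd sign.  The mod 2 cochain
   a_0 \cup da_1 \cup .. \cup da_(2n-1) is supported near the zeros of F, as each
   F_i changes sign on any simplex of its support; hence it vanishes on the
   frontier of a symmetric neighbourhood U of A.  But its coboundary summed over
   U is 1: antipodal simplices cancel except in the star of the origin, where
   the signs can be prescribed so that exactly one simplex contributes. *)

Require Import Defs.
From HB Require Import structures.
From mathcomp Require Import all_boot all_order all_algebra finmap.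
From mathcomp Require Import all_classical all_reals.
From mathcomp Require Import topology normedtype.
From mathcomp Require Import fingroup perm zify ring lra.

Set Implicit Arguments.
Unset Strict Implicit.
Unset Printing Implicit Defensive.

Import Order.TTheory GRing.Theory Num.Theory.
Import numFieldNormedType.Exports.
Local Open Scope classical_set_scope.
Local Open Scope ring_scope.

(** * Parity of alternating flags *)

Lemma even_size_involution (T : eqType) (f : T -> T) (s : seq T) : uniq s ->
  (forall x, x \in s -> [/\ f x \in s, f (f x) = x & f x != x]) ->
  ~~ odd (size s).
Proof.
have [n] := ubnP (size s); elim: n s => // n IHn [|x s] //=.
rewrite ltnS => les /andP[xs us] fs.
have [fx ffx nfx] := fs x (mem_head _ _).
have {fx} fxs : f x \in s by move: fx; rewrite inE (negPf nfx).
have szs : size s = (size (rem (f x) s)).+1.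
  by rewrite size_rem // prednK //; case: (s) fxs.
rewrite szs /= negbK; apply: IHn; rewrite ?rem_uniq //.
  by move: les; rewrite szs; lia.
move=> y; rewrite mem_rem_uniq // inE => /andP[yfx ys].
have [|fy ffy nfy] := fs y; first by rewrite inE ys orbT.
split=> //.
rewrite mem_rem_uniq // inE.
have -> /= : f y != f x by apply: contraNneq xs => e; rewrite -ffx -e ffy.
move: fy; rewrite inE => /predU1P[e|//].
by rewrite -e ffy eqxx in yfx.
Qed.

(** Behind both cancellations modulo 2: the simplices on the two sides of a facet, and antipodal
    simplices, come in pairs. *)
Lemma sum_involution (T : eqType) (f : T -> T) (s : seq T) (g : pred T) :
  uniq s ->
  (forall x, x \in s -> g x ->
    [/\ f x \in s, g (f x), f (f x) = x & f x != x]) ->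
  \big[addb/false]_(x <- s) g x = false.
Proof.
move=> us fs.
have -> : \big[addb/false]_(x <- s) g x = odd (size [seq x <- s | g x]).
  elim: s {us fs} => [|x s IHs]; first by rewrite big_nil.
  by rewrite big_cons IHs /=; case: (g x).
apply: negbTE; apply: (even_size_involution (f := f)).
  exact: filter_uniq.
move=> x; rewrite mem_filter => /andP[gx xs].
by have [h1 h2 h3 h4] := fs x xs gx; split; rewrite ?mem_filter ?h1 ?h2.
Qed.

(** * Cup products of sign cochains modulo 2 *)

Section Cochains.

(* [u i j] stands for a_i(u_j), the value of the 0-cochain a_i at the j-th
   vertex of a simplex; [cup] is a_0 \cup da_1 \cup .. \cup da_k. *)
Definition cup (k : nat) (u : nat -> nat -> bool) : bool :=
  u 0 0 && \big[andb/true]_(i < k) (u i.+1 i (+) u i.+1 i.+1).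

Definition dcup (k : nat) (u : nat -> nat -> bool) : bool :=
  \big[andb/true]_(i < k) (u i i (+) u i i.+1).

Lemma eq_cup k u v :
  (forall i j, (i <= k)%N -> (j <= k)%N -> u i j = v i j) -> cup k u = cup k v.
Proof.
move=> uv; rewrite /cup uv //; congr andb; apply: eq_bigr => i _.
by rewrite !uv // ltnW.
Qed.

(** The Leibniz rule together with dd = 0. Induction splits off the last factor: the faces opposite
    to the last two vertices agree in all earlier factors, and their last factors add up to the
    difference along the edge from vertex k+1 to vertex k+2. *)
Lemma dcup_coboundary k u :
  dcup k.+1 u = \big[addb/false]_(j < k.+2) cup k (fun i l => u i (bump j l)).
Proof.
elim: k => [|k IHk].
  rewrite /dcup /cup !big_ord_recl !big_ord0 /= !andbT addbF.
  by rewrite /bump /= addbC.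
have cupS v : cup k.+1 v = cup k v && (v k.+1 k (+) v k.+1 k.+1).
  by rewrite /cup big_ord_recr /= andbA.
have dcupS : dcup k.+2 u = dcup k.+1 u && (u k.+1 k.+1 (+) u k.+1 k.+2).
  by rewrite {1}/dcup big_ord_recr.
rewrite dcupS IHk.
rewrite [RHS]big_ord_recr /= [in RHS]big_ord_recr /= [in LHS]big_ord_recr /=.
rewrite andb_addl -addbA; congr addb.
  rewrite big_distrl /=; apply: eq_bigr => j _; rewrite cupS.
  by have jk := ltn_ord j; congr (_ && (u _ _ (+) u _ _)); rewrite /bump; lia.
rewrite !cupS.
have -> : cup k (fun i l => u i (bump k.+2 l)) =
          cup k (fun i l => u i (bump k.+1 l)).
  by apply: eq_cup => i j _ jk; congr (u _ _); rewrite /bump; lia.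
rewrite -andb_addr; congr andb.
have -> : bump k.+1 k = k by rewrite /bump; lia.
have -> : bump k.+1 k.+1 = k.+2 by rewrite /bump; lia.
have -> : bump k.+2 k = k by rewrite /bump; lia.
have -> : bump k.+2 k.+1 = k.+1 by rewrite /bump; lia.
by rewrite addbACA addbb addFb addbC.
Qed.

End Cochains.

(** * Barycentric subdivision of the cubes centred at the even grid points *)

Section Flags.
Variable k : nat.
Local Notation I := 'I_k.+1.

Definition gridpoint := {ffun I -> int}.

(* [(c, p, s)] encodes the top-dimensional simplex with vertices v_0, ..,
   v_(k+1), where v_0 = 2 c and v_(j+1) is obtained from v_j by moving one unit
   along the coordinate of rank j (in the direction prescribed by [s]). *)
Definition flag := (gridpoint * {perm I} * {ffun I -> bool})%type.

Implicit Types (t : flag) (c v : gridpoint) (p : {perm I}) (s : {ffun I -> bool}).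

Definition flag_vertex t (j : nat) : gridpoint :=
  [ffun i => t.1.1 i *+ 2 + (if (t.1.2 i < j)%N then (-1) ^+ t.2 i else 0)].

Definition flip s (i0 : I) : {ffun I -> bool} := [ffun i => s i (+) (i == i0)].

Definition advance c s (i0 : I) : gridpoint :=
  [ffun i => c i + (if i == i0 then (-1) ^+ s i else 0)].

(* The top-dimensional simplex sharing with [t] the facet opposite to its
   vertex [j]. *)
Definition neighbour (j : nat) t : flag :=
  let: (c, p, s) := t in
  if j == 0%N then let i0 := (p^-1)%g ord0 in (advance c s i0, p, flip s i0)
  else if j == k.+1 then (c, p, flip s ((p^-1)%g ord_max))
  else (c, (p * tperm (inord j.-1) (inord j))%g, s).

(** Without v_0 the facet lies in the wall between two adjacent cubes, so the first step can be
    taken from the other centre. Without the last vertex the last step can be reversed, and without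
    any other vertex the two steps around it can be swapped. *)
Lemma neighbour_vertex j t l : (j <= k.+1)%N -> (l <= k.+1)%N -> l != j ->
  flag_vertex (neighbour j t) l = flag_vertex t l.
Proof.
case: t => [[c p] s] jk lk lj; apply/ffunP => i; rewrite /neighbour.
have [j0|jN0] := eqVneq j 0%N.
  rewrite /= !ffunE /= ?ffunE; have [ei|] := eqVneq i ((p^-1)%g ord0); last first.
    by rewrite addr0 addbF.
  have -> : (p i < l)%N by rewrite ei permKV /= lt0n -j0.
  by case: (s i); rewrite /=; ring.
have [ej|jNk] := eqVneq j k.+1.
  rewrite /= !ffunE /=; case: ifP => // pil; rewrite ?ffunE.
  have [ei|] := eqVneq i ((p^-1)%g ord_max); last by rewrite addbF.
  by move: pil; rewrite ei permKV /=; lia.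
rewrite /= !ffunE /= permM.
have ij : nat_of_ord (inord j : I) = j by rewrite inordK //; lia.
have ij1 : nat_of_ord (inord j.-1 : I) = j.-1 by rewrite inordK //; lia.
suff -> : (tperm (inord j.-1) (inord j) (p i) < l)%N = (p i < l)%N by [].
by case: tpermP => [->|->|//]; rewrite ij ij1; lia.
Qed.

Lemma neighbourK j t : (j <= k.+1)%N -> neighbour j (neighbour j t) = t.
Proof.
case: t => [[c p] s] jk; rewrite /neighbour.
have flipK s' i0 : flip (flip s' i0) i0 = s'.
  by apply/ffunP => i; rewrite !ffunE addbK.
case: ifP => [j0|jN0].
  rewrite flipK; congr (_, _, _); apply/ffunP => i; rewrite !ffunE.
  by case: eqVneq => //= _; rewrite ?addr0 // addbT; case: (s i) => /=; ring.
case: ifP => [ej|jNk]; first by rewrite flipK.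
by rewrite -mulgA tperm2 mulg1.
Qed.

Lemma neighbour_neq j t : (j <= k.+1)%N -> neighbour j t != t.
Proof.
case: t => [[c p] s] jk; rewrite /neighbour.
have flipN s' i0 : flip s' i0 != s'.
  apply/eqP => /ffunP/(_ i0); rewrite ffunE eqxx addbT.
  by case: (s' i0).
case: ifP => [j0|jN0].
  by apply/eqP => -[_] /eqP; rewrite (negPf (flipN _ _)).
case: ifP => [ej|jNk].
  by apply/eqP => -[] /eqP; rewrite (negPf (flipN _ _)).
apply/eqP => -[]; rewrite -[RHS]mulg1 => /mulgI /permP /(_ (inord j)).
rewrite tpermR perm1 => /(congr1 (@nat_of_ord _)).
rewrite !inordK; lia.
Qed.

Definition antipode t : flag :=
  let: (c, p, s) := t in (- c, p, [ffun i => ~~ s i]).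

Lemma antipodeK : involutive antipode.
Proof.
move=> [[c p] s]; rewrite /antipode opprK; congr (_, _, _).
by apply/ffunP => i; rewrite !ffunE negbK.
Qed.

Lemma antipode_neq t : antipode t != t.
Proof.
case: t => [[c p] s]; apply/eqP => -[_] /ffunP/(_ ord0).
by rewrite ffunE; case: (s ord0).
Qed.

Lemma antipode_vertex t j : flag_vertex (antipode t) j = - flag_vertex t j.
Proof.
case: t => [[c p] s]; apply/ffunP => i; rewrite !ffunE /= ?ffunE mulNrn.
case: ifP => _; last by ring.
by case: (s i) => /=; ring.
Qed.

(** The sign of the last nonzero coordinate, which is odd away from the origin. It serves as a_0
    everywhere and as every a_i in the star of the origin. *)
Definition top_pos v : bool :=
  [exists i, (0 < v i) && [forall j : I, (i < j)%N ==> (v j == 0)]].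

Lemma top_posE v (i : I) : v i != 0 ->
  (forall j : I, (i < j)%N -> v j = 0) -> top_pos v = (0 < v i).
Proof.
move=> vi vj; apply/existsP/idP => [[i' /andP[vi' /forallP vj']]|vi0].
  have [ii'|ii'|ii'] := ltngtP i i'.
  - by rewrite vj ?ltxx in vi'.
  - by move: vi; rewrite (eqP (implyP (vj' i) ii')) eqxx.
  - by rewrite (val_inj ii').
exists i; rewrite vi0 /=; apply/forallP => j; apply/implyP => ij.
by rewrite vj.
Qed.

Lemma top_coord v : v != 0 -> exists2 i : I, v i != 0 &
  forall j : I, (i < j)%N -> v j = 0.
Proof.
move=> v0; have /existsP[i0 vi0] : [exists i, v i != 0].
  apply: contraNT v0 => /existsPn vi; apply/eqP/ffunP => i.
  by rewrite ffunE; apply/eqP; have := vi i; rewrite negbK.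
case: (@arg_maxnP _ i0 (fun i => v i != 0) (@nat_of_ord _)) => // i vi mi.
exists i => // j ij; apply/eqP; apply: contraTT ij => vj.
by rewrite -leqNgt; exact: mi.
Qed.

Lemma top_posN v : v != 0 -> top_pos (- v) = ~~ top_pos v.
Proof.
move=> /top_coord[i vi vj].
rewrite (top_posE vi vj) (@top_posE (- v) i) ?ffunE ?oppr_eq0 //.
  by rewrite oppr_gt0 -leNgt le_eqVlt (negPf vi).
by move=> j ij; rewrite ffunE vj ?oppr0.
Qed.

Lemma top_pos0 : top_pos 0 = false.
Proof. by apply/existsP => -[i]; rewrite ffunE ltxx. Qed.

(** By parity, a flag can have the origin as a vertex only when its centre 2c is the origin. *)
Lemma double_sign_eq0 (x : int) (b c : bool) :
  x *+ 2 + (if b then (-1) ^+ c else 0) = 0 -> x = 0.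
Proof. by rewrite mulr2n; case: b; case: c => /=; lia. Qed.

Lemma perm_mono_id (p : {perm I}) :
  (forall i j, (p i < p j)%N -> (i < j)%N) -> p = 1%g.
Proof.
move=> pm; suff pE n (i : I) : (i < n)%N -> p i = i.
  by apply/permP => i; rewrite perm1 (pE i.+1).
elim: n i => // n IHn i; rewrite ltnS => lin.
have [lt|gt|/val_inj//] := ltngtP (p i) i.
  by have /perm_inj := IHn _ (leq_trans lt lin).
have lt : (p ((p^-1)%g i) < p i)%N by rewrite permKV.
have := IHn _ (leq_trans (pm _ _ lt) lin); rewrite permKV => e.
by have := pm _ _ lt; rewrite -e ltnn.
Qed.

Lemma gridpoint0E (i : I) : (0 : gridpoint) i = 0.
Proof. by rewrite ffunE. Qed.

Lemma vertex0E p s j (i : I) :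
  flag_vertex (0, p, s) j i = if (p i < j)%N then (-1) ^+ s i else 0.
Proof. by rewrite ffunE /= ?ffunE mul0rn add0r. Qed.

Lemma vertex0_neq0 p s j (i : I) :
  (flag_vertex (0, p, s) j i != 0) = (p i < j)%N.
Proof. by rewrite vertex0E; case: ifP; rewrite ?eqxx // signr_eq0. Qed.

Lemma top_pos_vertex0 s j (jk : (j < k.+1)%N) :
  top_pos (flag_vertex (0, 1%g, s) j.+1) = ~~ s (Ordinal jk).
Proof.
rewrite (@top_posE _ (Ordinal jk)) ?vertex0_neq0 ?perm1 //=.
  by rewrite vertex0E perm1 /= ltnSn; case: (s _).
by move=> i /= ij; apply/eqP/negPn; rewrite vertex0_neq0 perm1 -leqNgt.
Qed.

(* Consecutive signs can only differ when the newest coordinate is the topmost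
   one: this leaves the identity ranking with alternating directions. *)
Lemma alternating_flag p s :
  \big[andb/true]_(i < k.+1) (top_pos (flag_vertex (0, p, s) i)
    (+) top_pos (flag_vertex (0, p, s) i.+1)) =
  ((p, s) == (1%g, [ffun i => odd (nat_of_ord i)])).
Proof.
have v0 p' s' : flag_vertex (0, p', s') 0 = 0.
  by apply/ffunP => i; rewrite vertex0E gridpoint0E.
rewrite big_andE; apply/forallP/eqP => [alt|[-> ->] [j jk]] /=; last first.
  case: j jk => [|j] jk; rewrite (top_pos_vertex0 _ jk) ffunE /=.
    by rewrite v0 top_pos0.
  by rewrite (top_pos_vertex0 _ (ltnW jk)) ffunE /=; case: odd.
(* If q <= i but i is moved before q, then the topmost nonzero coordinate i0 is already at or above
   i when q moves. The move of q changes nothing from i0 upwards, so the sign stays the same there,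
   against [alt]. *)
have p1 : p = 1%g.
  apply: perm_mono_id => i q piq; rewrite ltnNge; apply/negP => qi.
  have vi0 : flag_vertex (0, p, s) (p q) i != 0 by rewrite vertex0_neq0.
  have [|i0 vi vj] := @top_coord (flag_vertex (0, p, s) (p q)).
    by apply: contraNneq vi0 => ->; rewrite ffunE.
  have ii0 : (i <= i0)%N by rewrite leqNgt; apply/negP => /vj/eqP/negPn/negP[].
  have same (l : I) : (i0 <= l)%N ->
      flag_vertex (0, p, s) (p q).+1 l = flag_vertex (0, p, s) (p q) l.
    move=> i0l; rewrite !vertex0E ltnS leq_eqVlt.
    suff /negPf -> : nat_of_ord (p l) != p q by [].
    apply/eqP => /val_inj/perm_inj lq.
    have iq : i = q by apply/val_inj/eqP; rewrite /= eqn_leq qi (leq_trans ii0) -?lq.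
    by rewrite iq ltnn in piq.
  have := alt (p q); rewrite /= (top_posE vi vj).
  rewrite (@top_posE _ i0) ?same ?addbb //.
  by move=> j ij; rewrite same ?vj // ltnW.
subst p; congr (_, _); apply/ffunP => -[j jk]; rewrite ffunE /=.
elim: j jk => [|j IHj] jk.
  have := alt (Ordinal jk); rewrite /= v0 top_pos0 (top_pos_vertex0 _ jk).
  by case: (s _).
have := alt (Ordinal jk); rewrite /= (top_pos_vertex0 _ jk).
by rewrite (top_pos_vertex0 _ (ltnW jk)) IHj; case: (s _) => //=; case: odd.
Qed.

(* The antipode cancels the flags whose first vertex is not the origin. *)
Theorem odd_parity (a : nat -> gridpoint -> bool) (E : seq gridpoint) :
  uniq E -> 0 \in E -> (forall c, c \in E -> - c \in E) ->
  (forall v, a 0%N v = top_pos v) ->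
  (forall i v, (i <= k)%N -> v != 0 -> a i (- v) = ~~ a i v) ->
  (forall i v, (i <= k)%N -> v != 0 -> (forall j, `|v j| <= 1) ->
     a i v = top_pos v) ->
  (forall t, t.1.1 \in E -> (neighbour 0 t).1.1 \notin E ->
     exists2 i, (i < k)%N &
       a i.+1 (flag_vertex t i.+1) = a i.+1 (flag_vertex t i.+2)) ->
  False.
Proof.
move=> uE E0 EN a0 aN alink abd.
pose S : seq flag := [seq (c, ps.1, ps.2) | c <- E,
  ps <- enum ({: {perm I} * {ffun I -> bool}})].
have uS : uniq S.
  apply: allpairs_uniq => //; first exact: enum_uniq.
  by move=> [c [p s]] [c' [p' s']] _ _ /= [-> -> ->].
have inS t : (t \in S) = (t.1.1 \in E).
  case: t => [[c p] s]; apply/allpairsP/idP => [[[c' ps] [/= cE _ [-> _ _]]] //|].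
  by move=> cE; exists (c, (p, s)); rewrite mem_enum; split.
pose u t i j := a i (flag_vertex t j).
(* Exchanging the sums, each facet of a flag in [S] is matched with the same facet of its neighbour.
   The neighbour leaves [S] only across a facet opposite to v_0, and there [abd] makes a factor of
   the cup product vanish. *)
have sum0 : \big[addb/false]_(t <- S) dcup k.+1 (u t) = false.
  under eq_bigr do rewrite dcup_coboundary.
  rewrite exchange_big big1 //= => -[j jk] _ /=.
  apply: (sum_involution (f := neighbour j)) => // t tS cupt.
  have cupn : cup k (fun i l => u (neighbour j t) i (bump j l)).
    rewrite (eq_cup (v := fun i l => u t i (bump j l))) // => i l _ lk.
    by congr (a _ _); apply: neighbour_vertex; rewrite // /bump; lia.
  split; [|by []|exact: neighbourK|exact: neighbour_neq].
  rewrite inS; have [j0|] := eqVneq j 0%N; last first.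
    move=> jN0; move: tS; rewrite inS; case: t {cupt cupn} => [[c p] s].
    by rewrite /neighbour (negPf jN0); case: ifP.
  subst j; apply/negPn/negP => nE; move: tS; rewrite inS => tE.
  have [i ik e] := abd t tE nE.
  move: cupt; rewrite /cup => /andP[_]; rewrite big_andE => /forallP.
  by move=> /(_ (Ordinal ik)); rewrite /u /bump /= add1n e addbb.
suff : \big[addb/false]_(t <- S) dcup k.+1 (u t) = true by rewrite sum0.
pose t0 : flag := (0, 1%g, [ffun i => odd (nat_of_ord i)]).
rewrite (bigID (fun t : flag => t.1.1 == 0)) /= [X in _ (+) X]big_mkcond /=.
rewrite [X in _ (+) X](_ : _ = false); last first.
  have -> : \big[addb/false]_(i <- S) (if i.1.1 != 0 then dcup k.+1 (u i) else false) =
    \big[addb/false]_(i <- S) ((i.1.1 != 0) && dcup k.+1 (u i)).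
    by apply: eq_bigr => t _; case: ifP.
  apply: (sum_involution (f := antipode)) => // t; rewrite !inS => tE /andP[tN0 dt].
  have anti1 : (antipode t).1.1 = - t.1.1 by case: (t) => [[]].
  rewrite anti1 EN // oppr_eq0 tN0 antipodeK; split=> //; last exact: antipode_neq.
  suff -> : dcup k.+1 (u (antipode t)) = dcup k.+1 (u t) by [].
  apply: eq_bigr => i _; rewrite /u !antipode_vertex.
  have vN0 j : flag_vertex t j != 0.
    apply: contraNneq tN0 => /ffunP e; apply/eqP/ffunP => i'.
    have := e i'; rewrite ffunE !gridpoint0E; exact: double_sign_eq0.
  have ik : (i <= k)%N by rewrite -ltnS.
  by rewrite !aN //; case: (a i _); case: (a i _).
rewrite addbF.
(* All coordinates of the vertices of a flag centred at the origin lie in {-1, 0, 1}, so every sign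
   involved is [top_pos] and the alternating flag is the only one that counts. The origin itself
   enters only through a_0. *)
have -> : \big[addb/false]_(t <- S | t.1.1 == 0) dcup k.+1 (u t) =
          \big[addb/false]_(t <- S | t == t0) true.
  rewrite big_mkcond [RHS]big_mkcond; apply: eq_bigr => -[[c p] s] _ /=.
  rewrite -[_ == t0]/((c == 0) && (p == 1%g) && (s == [ffun i => odd (nat_of_ord i)])).
  case: eqVneq => //= c0; subst c.
  transitivity ((p, s) == (1%g, [ffun i => odd (nat_of_ord i)])); last by case: ifP.
  rewrite -alternating_flag; apply: eq_bigr => -[i ik] _ /=.
  have lnk j l : (j <= k)%N -> (0 < l)%N ->
      u (0, p, s) j l = top_pos (flag_vertex (0, p, s) l).
    move=> jk l0; apply: alink => //.
      apply/eqP => /ffunP /(_ ((p^-1)%g ord0)); rewrite [RHS]ffunE => /eqP.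
      by apply/negP; rewrite vertex0_neq0 permKV.
    by move=> j'; rewrite vertex0E; case: ifP => _; case: (s j').
  rewrite (lnk i i.+1) //; case: i ik => [|i] ik; first by rewrite /u a0.
  by rewrite lnk.
rewrite -big_filter (_ : [seq t <- S | t == t0] = [:: t0]) ?big_seq1 //.
by rewrite filter_pred1_uniq // inS.
Qed.

End Flags.

(** * Zero sets of odd maps *)

(** A Lebesgue number, with a property [Q] of sets that passes to subsets in place of an open
    cover. *)
Lemma lebesgue_number (R : realType) (V : pseudoMetricType R) (K : set V)
    (Q : set V -> Prop) : compact K ->
  (forall S S', S `<=` S' -> Q S' -> Q S) ->
  (forall x, K x -> exists2 e : R, 0 < e & Q (ball x e)) ->
  exists2 e : R, 0 < e & forall x, K x -> Q (ball x e).
Proof.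
move=> /compact_near_coveringP cK Qsub Qx.
have [|e e0 He] := (cK R 0^'+ (fun e x => Q (ball x e)) _ _); last first.
  have e20 : 0 < e / 2 by rewrite divr_gt0.
  exists (e / 2) => // x Kx; apply: He => //=.
  by rewrite sub0r normrN gtr0_norm // ltr_pdivrMr // ltr_pMr // ltr1n.
move=> x /Qx[e e0 Qe]; exists (ball x (e / 2), [set d | d < e / 2]) => /=.
  split; first by apply: nbhsx_ballx; rewrite divr_gt0.
  by apply: nbhs_right_lt; rewrite divr_gt0.
move=> [y d] /= [xy de]; apply: Qsub Qe => z yz.
rewrite [e]splitr; apply: ball_triangle xy _.
by apply: le_ball yz; exact: ltW.
Qed.

Section RowNorm.
Variables (R : realType) (k : nat).
Implicit Types x y : 'rV[R]_k.

Lemma row_norm_ltP x (e : R) : 0 < e ->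
  `|x| < e <-> forall i, `|x 0 i| < e.
Proof.
move=> e0; have := @mx_norm_ball R 1 k.
move=> /(congr1 (fun f => f 0 e x)); rewrite /ball_ /= sub0r normrN => <-.
split=> [[_ h] i|h].
  by have := h 0 i; rewrite -ball_normE /ball_ /= mxE sub0r normrN.
by split=> // i j; rewrite -ball_normE /ball_ /= mxE sub0r normrN ord1; exact: h.
Qed.

Lemma row_normW x i : `|x 0 i| <= `|x|.
Proof.
apply/ler_addgt0Pr => e e0; apply: ltW; apply: (row_norm_ltP _ _).1.
  by rewrite ltr_wpDl.
by rewrite ltrDl.
Qed.

End RowNorm.

Section IsolatedZeros.
Variables (R : realType) (k : nat).
Local Notation V := 'rV[R]_k.+1.

Definition scaled_point (h : R) (v : gridpoint k) : V := \row_i (h * (v i)%:~R).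

Lemma scaled_pointN h (v : gridpoint k) : scaled_point h (- v) = - scaled_point h v.
Proof. by apply/rowP => i; rewrite !mxE ffunE mulrNz mulrN. Qed.

Lemma scaled_point_dist h (v w : gridpoint k) (d : nat) (e : R) : 0 < h -> h * d%:R < e ->
  (forall i, `|v i - w i| <= d%:Z) ->
  `|scaled_point h v - scaled_point h w| < e.
Proof.
move=> h0 hd vw; have e0 : 0 < e by apply: le_lt_trans hd; rewrite mulr_ge0 // ltW.
apply/row_norm_ltP => // i; rewrite !mxE -mulrBr normrM gtr0_norm //.
apply: le_lt_trans hd; rewrite ler_pM2l // -intrB -intr_norm.
by rewrite -[d%:R]/(d%:Z%:~R) ler_int.
Qed.

(** Only the centres 2c of cubes are listed, since they alone decide which flags enter the sum. *)
Lemma finite_lattice_points (U : set V) (h : R) : 0 < h ->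
  (exists M, forall z, U z -> `|z| <= M) ->
  exists E : seq (gridpoint k), uniq E /\
    forall c, c \in E <-> U (scaled_point h (c *+ 2)).
Proof.
move=> h0 [M UM].
have [N MN] : exists N : nat, M / h < N%:R.
  have [M0|M0] := ltP (M / h) 0; first by exists 0%N.
  by exists (Num.bound (M / h)); rewrite archi_boundP.
pose toz (d : {ffun 'I_k.+1 -> 'I_(N + N).+1}) : gridpoint k :=
  [ffun i => (d i)%:Z - N%:Z].
exists (undup [seq c <- map toz (enum {: {ffun 'I_k.+1 -> 'I_(N + N).+1}})
  | `[< U (scaled_point h (c *+ 2)) >]]).
split=> [|c]; first exact: undup_uniq.
rewrite mem_undup mem_filter; split=> [/andP[/asboolP]//|Uc].
apply/andP; split; first exact/asboolP.
have cN i : `|c i| <= N%:Z.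
  have := le_trans (row_normW _ i) (UM _ Uc).
  rewrite mxE normrM gtr0_norm // mulrC -ler_pdivlMr // => le1.
  have := le_lt_trans le1 MN; rewrite -intr_norm -[N%:R]/(N%:Z%:~R) ltr_int.
  have -> : (c *+ 2) i = c i *+ 2 by rewrite !mulr2n ffunE.
  by lia.
apply/mapP; exists [ffun i => inord (absz (c i + N%:Z))]; first by rewrite mem_enum.
apply/ffunP => i; rewrite !ffunE inordK; have := cN i; lia.
Qed.

(** The Borsuk-Ulam statement: the zero set of an odd map to one dimension less has no compact
    symmetric piece that contains 0 and is open in it. [odd_parity] is applied to the signs of F on
    a fine grid, with [E] the centres in a neighbourhood [U] of the piece. *)
Theorem odd_map_zero_set (F : V -> 'rV[R]_k) (A : set V) :
  continuous F -> (forall z, F (- z) = - F z) ->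
  compact A -> A 0 -> (forall z, A z -> A (- z)) ->
  (forall a, A a -> \forall z \near a, F z = 0 -> A z) -> False.
Proof.
move=> cF oF cA A0 AN Anear.
have [eta eta0 etaA] : exists2 e : R, 0 < e &
    forall a, A a -> forall z, ball a e z -> F z = 0 -> A z.
  apply: (lebesgue_number (Q := fun S => forall z, S z -> F z = 0 -> A z)) => //.
    by move=> S S' SS' h z /SS'; exact: h.
  by move=> a /Anear/nbhs_ballP[e /= e0 he]; exists e.
(* Half of [eta], so that every zero of F whose small balls meet [U] is within [eta] of [A], hence
   in [A]. *)
pose U : set V := [set z | exists2 a, A a & ball a (eta / 2) z].
have eta20 : 0 < eta / 2 by rewrite divr_gt0.
have AU a : A a -> U a by move=> Aa; exists a => //; exact: ballxx.
have UN z : U z -> U (- z).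
  move=> [a Aa az]; exists (- a); first exact: AN.
  by move: az; rewrite -!ball_normE /ball_ /= -opprD normrN.
have [M UM] : exists M, forall z, U z -> `|z| <= M.
  have [M0 [M0r HM]] := compact_bounded cA.
  exists (M0 + 1 + eta / 2) => z [a Aa].
  rewrite -ball_normE /ball_ /= distrC => za.
  have aM : `|a| <= M0 + 1 by apply: (HM (M0 + 1)) => //; rewrite ltrDl.
  rewrite -[z](subrK a); apply: le_trans (ler_normD _ _) _.
  by rewrite addrC lerD // ltW.
pose B : set V := [set z | `|z| <= M].
have cB : compact B.
  apply: bounded_closed_compact.
    exists M; split; first exact: num_real.
    by move=> x Mx z; rewrite /B /= => /le_trans; apply; exact: ltW.
  have -> : B = (fun z => `|z|) @^-1` [set x | x <= M] by [].
  by apply: closed_comp => [z _|]; [exact: norm_continuous|exact: closed_le].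
pose Q (S : set V) := [\/ forall z, S z -> U z, forall z, S z -> ~ U z |
  exists i, (forall z, S z -> 0 < F z 0 i) \/ (forall z, S z -> F z 0 i < 0)].
have [d d0 Qd] : exists2 d : R, 0 < d & forall b, B b -> Q (ball b d).
  apply: lebesgue_number => //.
    move=> S S' SS' [h|h|[i [h|h]]].
    - by constructor 1 => z /SS'/h.
    - by constructor 2 => z /SS'/h.
    - by constructor 3; exists i; left => z /SS'/h.
    - by constructor 3; exists i; right => z /SS'/h.
  move=> b _; have [[a Aa ab]|nUb] := pselect (exists2 a, A a & ball a eta b);
    last first.
    exists (eta / 2) => //; constructor 2 => z bz [a Aa az]; apply: nUb.
    exists a => //; rewrite [eta]splitr; apply: ball_triangle az _.
    exact: ball_sym.
  have [Fb|/eqP Fb] := eqVneq (F b) 0.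
    exists (eta / 2) => //; constructor 1 => z bz; exists b => //.
    exact: (etaA _ Aa _ ab Fb).
  have [i Fbi] : exists i, F b 0 i != 0.
    apply/existsP; apply: contra_notT Fb => /existsPn Fb0.
    by apply/rowP => i; rewrite mxE; apply/eqP; have := Fb0 i; rewrite negbK.
  have cFi : {for b, continuous (fun z => F z 0 i)}.
    by apply: (@continuous_comp _ _ _ F (fun w : 'rV_k => w 0 i));
      [exact: cF|exact: coord_continuous].
  have [Fp|Fn|F0] := ltgtP (F b 0 i) 0; last by rewrite F0 eqxx in Fbi.
    have : \forall z \near b, F z 0 i < 0 by apply: (cvgr_lt _ cFi).
    by move=> /nbhs_ballP[e /= e0 he]; exists e => //; constructor 3; exists i; right.
  have : \forall z \near b, 0 < F z 0 i by apply: (cvgr_gt _ cFi).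
  by move=> /nbhs_ballP[e /= e0 he]; exists e => //; constructor 3; exists i; left.
pose m := Num.min d (eta / 2).
have m0 : 0 < m by rewrite lt_min d0.
(* The distances needed below are at most 2 grid units, and even 4 of them stay below m. *)
pose h := m / 8.
have h0 : 0 < h by rewrite divr_gt0.
have [E [uE inE]] := finite_lattice_points h0 (ex_intro _ M UM).
(* The indices are shifted by one: the sum selects coordinate i - 1 of F, and index 0 is kept for
   the extra sign a_0. Ties, and the grid points around the origin, are decided by [top_pos], which
   keeps all signs odd. *)
pose f (i : nat) v := \sum_(j < k | j.+1 == i) F (scaled_point h v) 0 j.
pose linked (v : gridpoint k) := [forall j, `|v j| <= 1].
pose a (i : nat) v := if (i == 0)%N || linked v then top_pos v else
  (0 < f i v) || (f i v == 0) && top_pos v.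
have linkedN v : linked (- v) = linked v.
  by apply: eq_forallb => j; rewrite ffunE normrN.
apply: (@odd_parity k a E) => //.
- apply/inE; have -> : scaled_point h (0 *+ 2) = 0.
    by apply/rowP => i; rewrite !mxE mul0rn ffunE mulr0z mulr0.
  exact: AU.
- move=> c /inE Uc; apply/inE; rewrite mulNrn scaled_pointN; exact: UN.
- move=> i v _ v0; rewrite /a linkedN top_posN //; case: ifP => // _.
  have -> : f i (- v) = - f i v.
    rewrite /f -sumrN; apply: eq_bigr => j _.
    by rewrite scaled_pointN oF mxE.
  rewrite oppr_gt0 oppr_eq0.
  by case: (ltgtP (f i v) 0) => //= _; case: top_pos.
- by move=> i v _ _ lv; rewrite /a (_ : linked v) ?orbT //; exact/forallP.
move=> t tE nE.
have near0 (v w : gridpoint k) (n : nat) : (n <= 4)%N ->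
    (forall i, `|v i - w i| <= n%:Z) ->
    `|scaled_point h v - scaled_point h w| < m.
  move=> n4; apply: scaled_point_dist => //.
  rewrite /h -mulrA gtr_pMr // -ltr_pdivlMl ?invr_gt0 // invrK mulr1.
  by rewrite (@le_lt_trans _ _ 4) ?ler_nat // ltr_nat.
have v0E : scaled_point h (t.1.1 *+ 2) = scaled_point h (flag_vertex t 0).
  congr scaled_point; apply/ffunP => i; rewrite [RHS]ffunE /= addr0.
  by rewrite !mulr2n ffunE.
have v0E' : scaled_point h ((neighbour 0 t).1.1 *+ 2) =
    scaled_point h (flag_vertex (neighbour 0 t) 0).
  congr scaled_point; apply/ffunP => i; rewrite [RHS]ffunE /= addr0.
  by rewrite !mulr2n ffunE.
have distv j l (t' : flag k) i : `|flag_vertex t' j i - flag_vertex t' l i| <= 1.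
  rewrite !ffunE opprD addrACA subrr add0r.
  by case: ifP => _; case: ifP => _; case: (t'.2 i).
have Uv0 : U (scaled_point h (flag_vertex t 0)) by rewrite -v0E; apply/inE.
have nUv0 : ~ U (scaled_point h (flag_vertex (neighbour 0 t) 0)).
  by rewrite -v0E' => /inE; apply/negP.
have vn j : (0 < j <= k.+1)%N -> flag_vertex (neighbour 0 t) j = flag_vertex t j.
  by move=> /andP[j0 jk]; apply: neighbour_vertex; rewrite // -lt0n.
have dist0 j : (0 < j <= k.+1)%N -> forall i,
    `|flag_vertex (neighbour 0 t) 0 i - flag_vertex t j i| <= 1.
  by move=> jk i; rewrite -vn.
have /Qd[QU|QnU|[i Qi]] := UM _ Uv0.
- case: nUv0; apply: QU; rewrite -ball_normE /ball_ /=.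
  suff : `|scaled_point h (flag_vertex t 0) -
    scaled_point h (flag_vertex (neighbour 0 t) 0)| < m.
    by move=> /lt_le_trans; apply; rewrite ge_min lexx.
  apply: (near0 _ _ 2%N) => // i.
  have := distv 0%N 1%N t i; have := dist0 1%N isT i; lia.
- by case: (QnU _ (ballxx _ d0)).
exists i => //.
(* Otherwise the centre of the neighbour would be within two grid units of 0, which lies in [A], and
   so would be in [U]. Hence the signs at these vertices are those of F. *)
have nlink j : (0 < j <= k.+1)%N -> ~~ linked (flag_vertex t j).
  move=> jk; apply/negP => /forallP lv; apply: nUv0; exists 0 => //.
  rewrite -ball_normE /ball_ /= distrC -[0 in X in _ - X](_ : scaled_point h 0 = 0).
    suff : `|scaled_point h (flag_vertex (neighbour 0 t) 0) - scaled_point h 0| < m.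
      by move=> /lt_le_trans; apply; rewrite ge_min lexx orbT.
    apply: (near0 _ _ 2%N) => // i'; rewrite gridpoint0E subr0.
    move: (dist0 j jk i') (lv i'); lia.
  by apply/rowP => i'; rewrite !mxE ffunE mulr0z mulr0.
have fE v : f i.+1 v = F (scaled_point h v) 0 i.
  rewrite /f (bigD1 i) //= big1 ?addr0 // => j /andP[/eqP[ji]].
  by rewrite (val_inj ji) eqxx.
have vball j : (0 < j <= k.+1)%N ->
    ball (scaled_point h (flag_vertex t 0)) d (scaled_point h (flag_vertex t j)).
  move=> jk; rewrite -ball_normE /ball_ /=.
  suff : `|scaled_point h (flag_vertex t 0) - scaled_point h (flag_vertex t j)| < m.
    by move=> /lt_le_trans; apply; rewrite ge_min lexx.
  by apply: (near0 _ _ 1%N) => // i'.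
have ik := ltn_ord i.
have r1 : (0 < i.+1 <= k.+1)%N by rewrite /= ltnW.
have r2 : (0 < i.+2 <= k.+1)%N by [].
rewrite /a /= (negPf (nlink _ r1)) (negPf (nlink _ r2)) !fE.
case: Qi => Qi.
  by rewrite !Qi //; exact: vball.
have q1 := Qi _ (vball _ r1); have q2 := Qi _ (vball _ r2).
by rewrite (lt_gtF q1) (lt_gtF q2) (lt_eqF q1) (lt_eqF q2).
Qed.

End IsolatedZeros.

(** * Loops in graphs *)

Section Words.
Variable G : graph.

(* The boolean is [true] when the edge is travelled backwards. *)
Definition step := (gedge G * bool)%type.
Implicit Types (a b c : gvertex G) (w : seq step) (m : gedge G -> int).

Definition step_src (x : step) := if x.2 then gtgt x.1 else gsrc x.1.
Definition step_tgt (x : step) := if x.2 then gsrc x.1 else gtgt x.1.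

Fixpoint walk a w b : Prop :=
  if w is x :: w' then step_src x = a /\ walk (step_tgt x) w' b else a = b.

Definition word_total m w : int := \sum_(x <- w) (-1) ^+ x.2 * m x.1.

Definition rev_word w : seq step := [seq (x.1, ~~ x.2) | x <- rev w].

Definition occ w (e : gedge G) : int := word_total (fun e' => (e' == e)%:R) w.

Lemma walk_cat a b c w w' : walk a w b -> walk b w' c -> walk a (w ++ w') c.
Proof.
elim: w a => [|x w IHw] a /=; first by move=> ->.
by move=> [-> xb] bc; split=> //; exact: IHw.
Qed.

Lemma walk_rev a b w : walk a w b -> walk b (rev_word w) a.
Proof.
elim: w a => [|[e o] w IHw] a /=; first by move=> ->.
move=> [ea /IHw wb]; rewrite /rev_word rev_cons map_rcons -cats1.
by apply: walk_cat wb _ => /=; rewrite -ea /step_src /step_tgt /=; case: (o).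
Qed.

Lemma word_total_cat m w w' : word_total m (w ++ w') = word_total m w + word_total m w'.
Proof. by rewrite /word_total big_cat. Qed.

Lemma word_total_rev m w : word_total m (rev_word w) = - word_total m w.
Proof.
rewrite /word_total /rev_word big_map -sumrN.
rewrite (perm_big w) ?perm_rev //=.
by apply: eq_bigr => -[e o] _ /=; case: o; ring.
Qed.

Lemma word_total_lin m m' (x y : int) w :
  word_total (fun e => x * m e - y * m' e) w = x * word_total m w - y * word_total m' w.
Proof.
rewrite /word_total !mulr_sumr -sumrB; apply: eq_bigr => -[e o] _ /=.
by ring.
Qed.

(** The points on edges and vertices reachable from a form a set whose preimage under each edge map
    is everything or empty; it is therefore open and closed. *)
Lemma connected_walk (R : realType) :
  connected [set: graph_space R G] -> forall a b, exists w, walk a w b.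
Proof.
move=> conn a b.
pose reach v := exists w, walk a w v.
pose vert (x : graph_space R G) := match x with inl v => v | inr eu => gsrc eu.1 end.
have step_reach e : reach (gsrc e) <-> reach (gtgt e).
  split=> -[w aw].
    by exists (w ++ [:: (e, false)]); apply: walk_cat aw _.
  by exists (w ++ [:: (e, true)]); apply: walk_cat aw _.
have vert_edge e t : reach (vert (edge_map e t)) <-> reach (gsrc e).
  rewrite /edge_map; case: insubP => [u _ _|_] //=.
  by case: ifP => // _; split=> /step_reach.
pose U := [set x | reach (vert x)].
have clop (P : Prop) (V : set (graph_space R G)) :
    (forall e t, V (edge_map e t) <-> (reach (gsrc e) <-> P)) -> open V.
  move=> VE; change (graph_open V) => e.
  have [re|nre] := pselect (reach (gsrc e) <-> P).
    rewrite (_ : _ @^-1` _ = setT); first exact: openT.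
    by apply/seteqP; split=> // t _; apply/VE.
  rewrite (_ : _ @^-1` _ = set0); first exact: open0.
  by apply/seteqP; split=> // t /VE.
have oU : open U.
  apply: (clop True) => e t; rewrite /U /= vert_edge; tauto.
have cU : closed U.
  rewrite -openC; apply: (clop False) => e t; rewrite /U /= vert_edge; tauto.
have : U = setT.
  apply: conn.
  - by exists (inl a); exists [::].
  - by exists U; rewrite ?setTI.
  - by exists U; rewrite ?setTI.
by move/seteqP => [_ /(_ (inl b) I)].
Qed.

(** The pairing of a cycle with the coboundary of f equals the pairing of its boundary with f. *)
Lemma cycle_sum (z : graph_chain G) (f : gvertex G -> rat) : graph_cycle z ->
  \sum_(e <- finsupp z) z e * (f (gtgt e) - f (gsrc e)) = 0.
Proof.
move=> cz.
pose S := undup (map (@gsrc G) (finsupp z) ++ map (@gtgt G) (finsupp z)).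
have fE v : v \in S -> f v = \sum_(u <- S) f u * (v == u)%:R.
  move=> vS; rewrite (bigD1_seq v) ?undup_uniq //= eqxx mulr1 big1 ?addr0 //.
  by move=> u uv; rewrite eq_sym (negPf uv) mulr0.
transitivity (\sum_(u <- S) f u * graph_boundary z u); last first.
  by apply: big1 => u _; rewrite cz mulr0.
under [RHS]eq_bigr do rewrite mulr_sumr.
rewrite exchange_big /=; apply: eq_big_seq => e eS.
have sS : gsrc e \in S by rewrite mem_undup mem_cat map_f.
have tS : gtgt e \in S by rewrite mem_undup mem_cat (map_f (@gtgt G)) ?orbT.
rewrite (fE _ sS) (fE _ tS) -sumrB mulr_sumr; apply: eq_bigr => u _.
by ring.
Qed.

(** If all 2 by 2 minors vanished, the two cycles would be linearly dependent and the zero cycle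
    would have two expressions in the basis. *)
Lemma independent_cycles (z : 'I_2 -> graph_chain G) :
  (forall c : graph_chain G, graph_cycle c -> exists! a : {ffun 'I_2 -> rat},
     forall e, c e = \sum_i a i * z i e) ->
  exists e1 e2, z ord0 e1 * z ord_max e2 != z ord0 e2 * z ord_max e1.
Proof.
move=> zb; apply: contrapT => nz.
have zz e1 e2 : z ord0 e1 * z ord_max e2 = z ord0 e2 * z ord_max e1.
  by apply/eqP; apply: contra_notT nz => h; exists e1, e2.
have [|a0 [_ a0u]] := zb [fsfun] .
  by move=> v; rewrite /graph_boundary finsupp0 big_seq_fset0.
have uniq0 (x y : rat) : (forall e, x * z ord0 e + y * z ord_max e = 0) ->
    x = 0 /\ y = 0.
  move=> xy; pose b x y : {ffun 'I_2 -> rat} := [ffun i => if i == ord0 then x else y].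
  have bz x' y' : (forall e, x' * z ord0 e + y' * z ord_max e = 0) -> a0 = b x' y'.
    move=> xy'; apply: a0u => e; rewrite fsfunE /= !big_ord_recl big_ord0 !ffunE /= addr0.
    by rewrite (_ : lift ord0 ord0 = ord_max) ?xy' //; apply: val_inj.
  have := bz _ _ xy; rewrite (bz 0 0) => [|e]; last by rewrite !mul0r addr0.
  by move=> /ffunP e; have := e ord0; have := e ord_max; rewrite !ffunE /= => <- <-.
have [e0 z0] : exists e, z ord0 e != 0.
  apply: contrapT => nz0; have [|/eqP + _] := uniq0 1 0; last by rewrite oner_eq0.
  move=> e; rewrite mul1r mul0r addr0; apply/eqP.
  by apply: contra_notT nz0 => h; exists e.
have [|_ /eqP] := uniq0 (z ord_max e0) (- z ord0 e0).
  by move=> e; have := zz e0 e; lra.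
by rewrite oppr_eq0 (negPf z0).
Qed.

Lemma dual_loops (R : realType) :
  connected [set: graph_space R G] -> first_betti_number_is G 2 ->
  exists (v : gvertex G) (wa wb : seq step) (ma mb : gedge G -> int) (d : int),
    [/\ walk v wa v /\ walk v wb v, d != 0,
        word_total ma wa = d /\ word_total ma wb = 0
      & word_total mb wa = 0 /\ word_total mb wb = d].
Proof.
move=> /connected_walk conn [z [cz zb]].
have [f1 [f2 zf]] := independent_cycles zb.
pose v := gsrc f1.
have [pth pthP] := choice (conn v).
(* Every edge is closed up to a loop at v through the chosen paths. *)
pose loop e := pth (gsrc e) ++ (e, false) :: rev_word (pth (gtgt e)).
have loopP e : walk v (loop e) v.
  apply: walk_cat (pthP _) _; split=> //=.
  exact: walk_rev.
have occ_loop e f : occ (loop e) f =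
    occ (pth (gsrc e)) f + ((e == f)%:R - occ (pth (gtgt e)) f).
  rewrite /loop -cat1s /occ !word_total_cat word_total_rev; congr (_ + (_ - _)).
  by rewrite /word_total big_seq1 /= mul1r.
(* A cycle is the combination of these loops with its own coefficients, since the contributions of
   the paths cancel by [cycle_sum]. Minors of cycles thus expand bilinearly into minors of loops,
   and one of the latter is nonzero. *)
have cE (c : graph_chain G) f : graph_cycle c ->
    c f = \sum_(e <- finsupp c) c e * (occ (loop e) f)%:~R.
  move=> cc; have := cycle_sum (fun u => (occ (pth u) f)%:~R) cc.
  move=> h; transitivity (c f - \sum_(e <- finsupp c) c e *
      ((occ (pth (gtgt e)) f)%:~R - (occ (pth (gsrc e)) f)%:~R)).
    by rewrite h subr0.
  rewrite -sumrN.
  have -> : c f = \sum_(e <- finsupp c) c e * (e == f)%:R.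
    have [fc|fc] := boolP (f \in finsupp c).
      rewrite (bigD1_seq f) //= eqxx mulr1 big1 ?addr0 // => e ef.
      by rewrite (negPf ef) mulr0.
    rewrite fsfun_dflt // big1_seq // => e /andP[_ ec].
    have [ef|] := eqVneq e f; last by rewrite mulr0.
    by rewrite ef (negPf fc) in ec.
  rewrite -big_split /=; apply: eq_bigr => e _; rewrite occ_loop.
  by rewrite intrD intrB; case: eqP => _; rewrite /= ?mulr1z ?mulr0z; ring.
have [e [f [e1 [e2 m]]]] : exists e f e1 e2,
    occ (loop e) e1 * occ (loop f) e2 != occ (loop e) e2 * occ (loop f) e1.
  apply: contrapT => no; move/eqP: zf; apply.
  rewrite !(cE (z _)) //.
  rewrite !big_distrlr /=; apply: eq_bigr => e _; apply: eq_bigr => f _.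
  rewrite mulrACA [RHS]mulrACA; congr (_ * _); rewrite -!intrM; congr (_%:~R).
  by apply/eqP; apply: contra_notT no => h; exists e, f, f1, f2.
exists v, (loop e), (loop f).
(* Cramer's rule: the coefficients are those of the adjugate of the matrix of counts of the two
   loops at e1 and e2. *)
exists (fun g => occ (loop f) e2 * (g == e1)%:R - occ (loop f) e1 * (g == e2)%:R).
exists (fun g => occ (loop e) e1 * (g == e2)%:R - occ (loop e) e2 * (g == e1)%:R).
exists (occ (loop e) e1 * occ (loop f) e2 - occ (loop e) e2 * occ (loop f) e1).
split; rewrite ?subr_eq0 //.
  by rewrite !(word_total_lin (fun g => (g == _)%:R)) -!/(occ _ _); split; ring.
by rewrite !(word_total_lin (fun g => (g == _)%:R)) -!/(occ _ _); split; ring.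
Qed.

End Words.

(** * Functions modulo Z and lifts of paths *)

Lemma glue_continuous (T U : topologicalType) (b : T -> bool) (f g : T -> U) :
  continuous f -> continuous g ->
  (forall x, (\forall y \near x, b y = b x) \/ f x = g x) ->
  continuous (fun x => if b x then f x else g x).
Proof.
move=> cf cg bfg x W; have [bx|fgx] := bfg x.
  rewrite /=; case: ifP => bxE Wx.
    by apply: filterS2 bx (cf x W Wx) => y /= -> Wy; rewrite bxE.
  by apply: filterS2 bx (cg x W Wx) => y /= -> Wy; rewrite bxE.
rewrite /= fgx if_same => Wx.
have Wf : \forall y \near x, W (f y) by apply: cf; rewrite fgx.
have Wg : \forall y \near x, W (g y) by exact: cg.
by apply: filterS2 Wf Wg => y fy gy /=; case: ifP.
Qed.

Lemma ge_or_near (R : realType) (T : topologicalType) (f : T -> R) (c : R) x :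
  continuous f -> (\forall y \near x, (f y <= c) = (f x <= c)) \/ f x = c.
Proof.
move=> cf; have [lt|gt|] := ltgtP (f x) c; [left|left|by right].
  have : \forall y \near x, f y < c by apply: (cvgr_lt _ (cf x)).
  by apply: filterS => y fy; rewrite ltW.
have : \forall y \near x, c < f y by apply: (cvgr_gt _ (cf x)).
by apply: filterS => y fy; rewrite leNgt fy.
Qed.

Section ModZ.
Variables (R : realType) (T : topologicalType).
Implicit Types f g : T -> R.

(* Continuity at x of f as a map to R/Z. *)
Definition continuous_modZ (f : T -> R) (x : T) : Prop :=
  forall e : R, 0 < e -> \forall y \near x,
    exists k : int, `|f y - f x - k%:~R| < e.

Lemma continuous_modZB f g x : continuous_modZ f x -> continuous_modZ g x ->
  continuous_modZ (fun y => f y - g y) x.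
Proof.
move=> cf cg e e0; have e20 : 0 < e / 2 by rewrite divr_gt0.
apply: filterS2 (cf _ e20) (cg _ e20) => y [k fk] [l gl].
exists (k - l); rewrite intrB [e]splitr.
rewrite [X in `|X|](_ : _ = (f y - f x - k%:~R) - (g y - g x - l%:~R)); last by ring.
exact: le_lt_trans (ler_normB _ _) (ltrD fk gl).
Qed.

(* The representative of x mod Z in [-1/2, 1/2). *)
Definition centered (x : R) : R := x - (Num.floor (x + 2^-1))%:~R.

Lemma centered_int x : x - centered x \is a Num.int.
Proof. by rewrite /centered opprB addrC subrK intr_int. Qed.

Lemma centered_le x : `|centered x| <= 1.
Proof.
have := floor_itv (x + 2^-1); rewrite intrD => /andP[h1 h2].
by rewrite /centered ler_norml; apply/andP; split; lra.
Qed.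

Lemma centeredE x (k : int) : `|x - k%:~R| < 2^-1 -> centered x = x - k%:~R.
Proof.
rewrite ltr_norml => /andP[h1 h2]; rewrite /centered.
by rewrite (@floor_def _ _ k) // intrD; apply/andP; split; lra.
Qed.

(** [centered] jumps only at half-integers, and the second hypothesis keeps f x away from them. *)
Lemma centered_continuous f x : continuous_modZ f x ->
  (exists k : int, `|f x - k%:~R| < 4^-1) ->
  {for x, continuous (fun y => centered (f y))}.
Proof.
move=> cf [k fk]; apply/cvgrPdist_lt => e e0.
have e40 : 0 < Num.min e 4^-1 by rewrite lt_min e0 invr_gt0 ltr0n.
apply: filterS (cf _ e40) => y [l]; rewrite lt_min => /andP[le1 le2].
rewrite (@centeredE _ k); last by apply: lt_trans fk _; lra.
rewrite (@centeredE _ (k + l)); last first.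
  rewrite intrD (_ : _ - _ = (f y - f x - l%:~R) + (f x - k%:~R)); last by ring.
  by apply: le_lt_trans (ler_normD _ _) _; lra.
rewrite -normrN intrD (_ : - _ = f y - f x - l%:~R) //; ring.
Qed.

End ModZ.

(** * Edge paths and circle-valued functions on a graph *)

Section Trace.
Variables (R : realType) (G : graph).
Local Notation GS := (graph_space R G).
Implicit Types (m : gedge G -> int) (w : seq (step G)) (x : step G).

(** The cochain [m] as a map to R/Z: vertices go to 0 and the edge e winds m e times around the
    circle. *)
Definition theta m (p : GS) : R :=
  match p with inl _ => 0 | inr eu => (m eu.1)%:~R * val eu.2 end.

Definition clamp (t : R) : R := Num.max 0 (Num.min 1 t).

Lemma clamp_continuous : continuous clamp.
Proof.
move=> t; apply: (@continuous_max _ _ (cst 0)); first exact: cst_continuous.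
by apply: (@continuous_min _ _ (cst 1)); first exact: cst_continuous.
Qed.

Lemma clamp_le0 t : t <= 0 -> clamp t = 0.
Proof. by move=> t0; rewrite /clamp; case: (leP 1 t) => ?; case: leP => ?; lra. Qed.

Lemma clamp_ge1 t : 1 <= t -> clamp t = 1.
Proof. by move=> t1; rewrite /clamp; case: (leP 1 t) => ?; case: leP => ?; lra. Qed.

Lemma clamp_id t : 0 <= t <= 1 -> clamp t = t.
Proof. by move=> /andP[t0 t1]; rewrite /clamp min_r // max_r. Qed.

Lemma clampN t : clamp (1 - t) = 1 - clamp t.
Proof.
have [t0|t0] := leP t 0; first by rewrite (clamp_le0 t0) clamp_ge1; lra.
have [t1|t1] := leP 1 t; first by rewrite (clamp_ge1 t1) clamp_le0; lra.
by rewrite [in RHS]clamp_id ?clamp_id //; apply/andP; split; lra.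
Qed.

Lemma clamp_itv t : 0 <= clamp t <= 1.
Proof.
have [t0|t0] := leP t 0; first by rewrite clamp_le0 // lexx ler01.
have [t1|t1] := leP 1 t; first by rewrite clamp_ge1 // lexx ler01.
by rewrite clamp_id; apply/andP; split; lra.
Qed.

Lemma edge_map_le0 (e : gedge G) (t : R) : t <= 0 -> edge_map e t = inl (gsrc e).
Proof.
move=> t0; rewrite /edge_map; case: insubP => [u /andP[t1 _] _|_]; first by exfalso; lra.
by rewrite t0.
Qed.

Lemma edge_map_ge1 (e : gedge G) (t : R) : 1 <= t -> edge_map e t = inl (gtgt e).
Proof.
move=> t0; rewrite /edge_map; case: insubP => [u /andP[_ t1] _|_]; first by exfalso; lra.
by rewrite ifF //; apply/negbTE; rewrite -ltNge; lra.
Qed.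

Lemma theta_edge m e t :
  theta m (edge_map e t) - (m e)%:~R * clamp t \is a Num.int.
Proof.
have [t0|t0] := leP t 0.
  by rewrite edge_map_le0 // clamp_le0 // mulr0 subr0 rpred0.
have [t1|t1] := leP 1 t.
  by rewrite edge_map_ge1 // clamp_ge1 // mulr1 sub0r rpredN intr_int.
rewrite /edge_map; case: insubP => [u _ /= ->|]; last by rewrite t0 t1.
by rewrite clamp_id ?subrr ?rpred0 //; apply/andP; split; lra.
Qed.

Lemma edge_map_continuous (e : gedge G) : continuous (@edge_map R G e).
Proof. by apply/continuousP => U; exact. Qed.

Lemma theta_modZ m p : continuous_modZ (theta m) p.
Proof.
move=> e e0; pose U := [set q | exists k : int, `|theta m q - theta m p - k%:~R| < e].
suff oU : open U.
  by apply: open_nbhs_nbhs; split=> //; exists 0; rewrite subrr subr0 normr0.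
change (graph_open U) => g.
have -> : edge_map g @^-1` U = \bigcup_(k : int)
    (fun t : R => (m g)%:~R * clamp t - (theta m p + k%:~R)) @^-1` ball 0 e.
  apply/seteqP; split=> t /=.
    move=> [k]; have /intrP[l tl] := theta_edge m g t.
    move=> h; exists (k - l) => //=; rewrite -ball_normE /ball_ /= sub0r normrN.
    move: h; congr (`|_| < e); rewrite intrB -tl; ring.
  move=> [k _]; rewrite /= -ball_normE /ball_ /= sub0r normrN => h.
  have /intrP[l tl] := theta_edge m g t.
  exists (k + l); move: h; congr (`|_| < e); rewrite intrD -tl; ring.
apply: bigcup_open => k _; apply: open_comp; last exact: ball_open.
move=> t _; apply: cvgB; last exact: cvg_cst.
by apply: cvgM; [exact: cvg_cst|exact: clamp_continuous].
Qed.

Definition step_map x (t : R) : GS := edge_map x.1 (if x.2 then 1 - t else t).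

Lemma step_map_continuous x : continuous (step_map x).
Proof.
case: x => e [] t; last exact: edge_map_continuous.
have -> : step_map (e, true) = edge_map e \o (fun t => 1 - t) by [].
apply: continuous_comp; last exact: edge_map_continuous.
by apply: cvgB; [exact: cvg_cst|].
Qed.

Lemma step_map_le0 x t : t <= 0 -> step_map x t = inl (step_src x).
Proof.
case: x => e [] t0; rewrite /step_map /step_src /=.
  by rewrite edge_map_ge1 //; lra.
by rewrite edge_map_le0.
Qed.

Lemma step_map_ge1 x t : 1 <= t -> step_map x t = inl (step_tgt x).
Proof.
case: x => e [] t0; rewrite /step_map /step_tgt /=.
  by rewrite edge_map_le0 //; lra.
by rewrite edge_map_ge1.
Qed.

Lemma theta_step m x t :
  theta m (step_map x t) - ((-1) ^+ x.2 * m x.1)%:~R * clamp t \is a Num.int.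
Proof.
have -> : ((-1) ^+ x.2 * m x.1)%:~R =
    if x.2 then - (m x.1)%:~R else (m x.1)%:~R :> R.
  by case: x.2; rewrite ?expr1 ?expr0 ?mulN1r ?mul1r ?rmorphN.
case: x => e [] /=; last exact: theta_edge.
have := theta_edge m e (1 - t); rewrite clampN /step_map /= => h.
rewrite (_ : _ - _ = theta m (edge_map e (1 - t)) - (m e)%:~R * (1 - clamp t) +
  (m e)%:~R); last by ring.
by apply: rpredD h _; exact: intr_int.
Qed.

Fixpoint trace (a : gvertex G) w (t : R) : GS :=
  if w is x :: w' then
    if t <= 1 then step_map x t else trace (step_tgt x) w' (t - 1)
  else inl a.

(** The lift to R of [theta m] along [trace], starting at 0: each letter adds a ramp over its unit
    of time. *)
Fixpoint word_lift m w (t : R) : R :=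
  if w is x :: w' then ((-1) ^+ x.2 * m x.1)%:~R * clamp t + word_lift m w' (t - 1)
  else 0.

Lemma trace_le0 a w b t : walk a w b -> t <= 0 -> trace a w t = inl a.
Proof.
case: w => [//|x w] /= [<- _] t0; rewrite ifT ?step_map_le0 //; lra.
Qed.

Lemma trace_continuous a w b : walk a w b -> continuous (trace a w).
Proof.
elim: w a => [|x w IHw] a /=; first by move=> _; exact: cst_continuous.
move=> [_ wb]; apply: glue_continuous; first exact: step_map_continuous.
  move=> t; apply: (@continuous_comp _ _ _ (fun t : R => t - 1)
    (trace (step_tgt x) w)); last exact: (IHw _ wb).
  by apply: cvgB; [|exact: cvg_cst].
have cid : continuous (fun y : R => y) by move=> ?; exact: cvg_id.
move=> t; have [|->] := ge_or_near 1 t cid; first by left.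
by right; rewrite step_map_ge1 // (trace_le0 wb) // subrr.
Qed.

Lemma word_lift_continuous m w : continuous (word_lift m w).
Proof.
elim: w => [|x w IHw] /= t; first exact: cst_continuous.
apply: cvgD.
  by apply: cvgM; [exact: cvg_cst|exact: clamp_continuous].
apply: (@continuous_comp _ _ _ (fun t : R => t - 1) (word_lift m w)); last exact: IHw.
by apply: cvgB; [|exact: cvg_cst].
Qed.

Lemma word_lift_le0 m w t : t <= 0 -> word_lift m w t = 0.
Proof.
elim: w t => //= x w IHw t t0; rewrite clamp_le0 // IHw ?mulr0 ?addr0 //; lra.
Qed.

Lemma word_lift_ge_size m w t : (size w)%:R <= t ->
  word_lift m w t = (word_total m w)%:~R.
Proof.
elim: w t => [|x w IHw] t; first by rewrite /word_total big_nil.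
rewrite /= -natr1 => tw.
rewrite /word_total big_cons intrD -/(word_total m w) IHw; last by lra.
by rewrite clamp_ge1 ?mulr1 //; have := ler0n R (size w); lra.
Qed.

Lemma theta_trace m a w b t : walk a w b ->
  theta m (trace a w t) - word_lift m w t \is a Num.int.
Proof.
elim: w a t => [|x w IHw] a t /=; first by rewrite subrr rpred0.
move=> [_ wb]; case: ifP => t1.
  by rewrite word_lift_le0 ?addr0; [exact: theta_step|lra].
rewrite clamp_ge1; last by lra.
rewrite mulr1 opprD addrCA addrC.
by rewrite -rmorphN rpredD ?intr_int // (IHw _ _ wb).
Qed.

Lemma word_lift_cat m w w' t :
  word_lift m (w ++ w') t = word_lift m w t + word_lift m w' (t - (size w)%:R).
Proof.
elim: w t => [|x w IHw] t; first by rewrite add0r subr0.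
by rewrite /= IHw addrA -natr1; congr (_ + word_lift _ _ _); ring.
Qed.

Definition word_norm m w : R := \sum_(x <- w) `|(m x.1)%:~R|.

Lemma word_lift_le m w t : `|word_lift m w t| <= word_norm m w.
Proof.
elim: w t => [|x w IHw] t /=; first by rewrite normr0 /word_norm big_nil.
rewrite /word_norm big_cons; apply: le_trans (ler_normD _ _) _.
apply: lerD (IHw _); rewrite intrM !normrM -[leRHS]mulr1.
apply: ler_pM; rewrite ?mulr_ge0 ?normr_ge0 //; last first.
  by have /andP[c0 c1] := clamp_itv t; rewrite ger0_norm.
by case: x.2; rewrite /= ?expr1 ?mulrN1z ?mulr1z ?normrN normr1 mul1r.
Qed.

Definition word_pow (N : nat) w := flatten (nseq N w).

Lemma walk_pow a w N : walk a w a -> walk a (word_pow N w) a.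
Proof. by move=> wa; elim: N => //= N IHN; exact: walk_cat wa IHN. Qed.

(** With one turn per unit of time the lift follows a line whose slope is the total of w. The error
    does not depend on N: completed turns contribute exactly, so only the current one counts. *)
Lemma word_lift_pow m w (N : nat) (t : R) : t <= N%:R ->
  `|word_lift m (word_pow N w) ((size w)%:R * t) - (word_total m w)%:~R * Num.max 0 t| <=
  word_norm m w + `|(word_total m w)%:~R|.
Proof.
elim: N t => [|N IHN] t tN.
  rewrite /= sub0r normrN max_l // mulr0 normr0 addr_ge0 //.
  by apply: sumr_ge0.
have [t0|t0] := leP t 0.
  rewrite word_lift_le0 ?mulr_ge0_le0 // mulr0 subr0 normr0 addr_ge0 //.
  by apply: sumr_ge0.
rewrite /= word_lift_cat; have [t1|t1] := leP t 1.
  rewrite [word_lift m (flatten _) _]word_lift_le0 ?addr0; last first.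
    by rewrite subr_le0 ler_piMr.
  apply: le_trans (ler_normB _ _) _; apply: lerD; first exact: word_lift_le.
  by rewrite normrM ler_piMr // gtr0_norm.
rewrite word_lift_ge_size; last by rewrite ler_peMr // ltW.
have := IHN (t - 1); rewrite max_r; last by lra.
rewrite -natr1 in tN; move=> /(_ _)/wrap[]; first by lra.
apply: le_trans; rewrite le_eqVlt; apply/orP; left; apply/eqP.
by rewrite mulrBr mulr1; congr (`|_|); ring.
Qed.

(** A compact set that contains the traces of all powers of w at once. *)
Definition hull (a : gvertex G) w : set GS :=
  [set p | p = inl a \/ exists x t, x \in w /\ p = edge_map x.1 t].

Lemma hull_compact a w : compact (hull a w).
Proof.
have -> : hull a w = [set inl a] `|`
    \big[setU/set0]_(x <- w) (edge_map x.1 @` `[0, 1]).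
  rewrite -bigcup_seq; apply/seteqP.
  split=> [p [->|[x [t [xw ->]]]]|p [->|[x xw [t _ <-]]]].
  - by left.
  - right; exists x => //; exists (clamp t).
      by rewrite /= in_itv /= clamp_itv.
    have [t0|t0] := leP t 0; first by rewrite clamp_le0 // !edge_map_le0.
    have [t1|t1] := leP 1 t; first by rewrite clamp_ge1 // !edge_map_ge1.
    by rewrite clamp_id // !ltW.
  - by left.
  - by right; exists x, t.
apply: compactU; first exact: compact_set1.
apply: bigsetU_compact => x _; apply: continuous_compact; last exact: segment_compact.
by apply: continuous_subspaceT; exact: edge_map_continuous.
Qed.

Lemma trace_hull a w b t : walk a w b -> hull a w (trace a w t).
Proof.
elim: w a t => [|x w IHw] a t /=; first by left.
move=> [_ wb]; case: ifP => t1.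
  right; exists x, (if x.2 then 1 - t else t); rewrite mem_head; split=> //.
have [->|[y [s [yw ->]]]] := IHw _ (t - 1) wb.
  right; exists x, (if x.2 then 0 else 1); rewrite mem_head; split=> //.
  by rewrite /step_tgt; case: (x.2); [rewrite edge_map_le0|rewrite edge_map_ge1].
by right; exists y, s; rewrite inE yw orbT.
Qed.

Lemma hull_pow a w N : hull a (word_pow N w) `<=` hull a w.
Proof.
move=> p [->|[x [t [xw ->]]]]; first by left.
by right; exists x, t; split=> //; move: xw => /flattenP[s /nseqP[-> _]].
Qed.

End Trace.

(** * Planes folded along tripods *)

Section Plane.
Variable R : realType.

(* A folding of the plane onto a tripod with legs of heights [leg_l], [leg_r]
   and [leg_u]: opposite points of the plane never land on the same leg. *)
Definition leg_r (z : R * R) : R := Num.max 0 (z.1 - Num.max 0 z.2).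
Definition leg_l (z : R * R) : R := Num.max 0 (- z.1 - Num.max 0 z.2).
Definition leg_u (z : R * R) : R := Num.max 0 (z.2 - `|z.1|).

Lemma pos_part_continuous (T : topologicalType) (f : T -> R) :
  continuous f -> continuous (fun x => Num.max 0 (f x)).
Proof.
move=> cf x; apply: (@continuous_max _ _ (cst 0)); first exact: cst_continuous.
exact: cf.
Qed.

Lemma leg_r_continuous : continuous leg_r.
Proof.
apply: pos_part_continuous => z; apply: cvgB; first exact: cvg_fst.
by apply: pos_part_continuous => ?; exact: cvg_snd.
Qed.

Lemma leg_l_continuous : continuous leg_l.
Proof.
apply: pos_part_continuous => z; apply: cvgB; first by apply: cvgN; exact: cvg_fst.
by apply: pos_part_continuous => ?; exact: cvg_snd.
Qed.

Lemma leg_u_continuous : continuous leg_u.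
Proof.
apply: pos_part_continuous => z; apply: cvgB; first exact: cvg_snd.
by apply: cvg_norm; exact: cvg_fst.
Qed.

(** For y >= 0 the opposite point has no upper part and its signed horizontal height is - x. The
    signed height of (x, y) never has the sign opposite to x, so the first bound controls x; the
    second then controls y - |x|. *)
Lemma leg_spread_ge0 (x y e : R) : 0 <= y ->
  `|leg_r (x, y) - leg_l (x, y) - (leg_r (- x, - y) - leg_l (- x, - y))| <= e ->
  `|leg_u (x, y) - leg_u (- x, - y)| <= e -> `|x| <= e /\ `|y| <= e + e.
Proof.
move=> y0; have w : Num.max 0 y = y by rewrite max_r.
have w' : Num.max 0 (- y) = 0 by rewrite max_l // oppr_le0.
have -> : leg_u (- x, - y) = 0.
  by rewrite /leg_u /= max_l //; have := normr_ge0 (- x); lra.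
have -> : leg_r (- x, - y) - leg_l (- x, - y) = - x.
  rewrite /leg_r /leg_l /= w' !subr0 opprK.
  by case: (leP 0 (- x)) => ?; case: (leP 0 x) => ?; lra.
rewrite /leg_r /leg_l /leg_u /= w subr0 (ger0_norm y0) !ler_norml.
have : (0 <= x /\ `|x| = x) \/ (x <= 0 /\ `|x| = - x) by case: ger0P => ?; lra.
move: `|x| => n nx.
by case: (leP 0 (x - y)) => ?; case: (leP 0 (- x - y)) => ?;
  case: (leP 0 (y - n)) => ? /andP[? ?] /andP[? ?];
  case: nx => -[? ?]; split; try (apply/andP; split); lra.
Qed.

Lemma leg_spread (x y e : R) :
  `|leg_r (x, y) - leg_l (x, y) - (leg_r (- x, - y) - leg_l (- x, - y))| <= e ->
  `|leg_u (x, y) - leg_u (- x, - y)| <= e -> `|x| <= e /\ `|y| <= e + e.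
Proof.
have [y0|y0] := leP 0 y; first exact: leg_spread_ge0.
rewrite distrC [X in _ -> X <= _ -> _]distrC => h1 h2.
have := @leg_spread_ge0 (- x) (- y) e; rewrite !opprK !normrN.
by apply => //; rewrite oppr_ge0 ltW.
Qed.

Lemma leg_le (z : R * R) (r : R) : `|z.1| <= r -> `|z.2| <= r ->
  [/\ leg_r z <= r, leg_l z <= r & leg_u z <= r].
Proof.
case: z => x y /=; rewrite /leg_r /leg_l /leg_u /= => xr yr.
have r0 : 0 <= r := le_trans (normr_ge0 _) xr.
have w0 : 0 <= Num.max 0 y by rewrite le_max lexx.
move: (xr) (yr); rewrite !ler_norml => /andP[? ?] /andP[? ?].
have := normr_ge0 x.
by split; rewrite ge_max r0 /=; lra.
Qed.

(** The three regions meet where the leg heights concerned are 0, and there all three rays are at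
    p. *)
Lemma tripod_map (T : topologicalType) (p : T) (gr gl gu : R -> T) :
  continuous gr -> continuous gl -> continuous gu ->
  gr 0 = p -> gl 0 = p -> gu 0 = p ->
  exists2 c : R * R -> T, continuous c &
    forall z, [\/ [/\ c z = gr (leg_r z), leg_l z = 0 & leg_u z = 0],
      [/\ c z = gl (leg_l z), leg_r z = 0 & leg_u z = 0] |
      [/\ c z = gu (leg_u z), leg_r z = 0 & leg_l z = 0]].
Proof.
move=> cr cl cu r0 l0 u0.
have w0 (y : R) : 0 <= Num.max 0 y by rewrite le_max lexx.
have yw (y : R) : y <= Num.max 0 y by rewrite le_max lexx orbT.
have xN (x : R) : - x <= `|x| by rewrite -normrN ler_norm.
have legu0 z : z.2 - `|z.1| <= 0 -> leg_u z = 0 by move=> ?; exact: max_l.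
have legl0 z : - z.1 - Num.max 0 z.2 <= 0 -> leg_l z = 0 by move=> ?; exact: max_l.
have legr0 z : z.1 - Num.max 0 z.2 <= 0 -> leg_r z = 0 by move=> ?; exact: max_l.
have legrl z : 0 <= - z.1 - Num.max 0 z.2 -> leg_r z = 0.
  by move=> h; apply: legr0; have := w0 z.2; lra.
have legur z : 0 <= z.2 - `|z.1| -> leg_r z = 0.
  by move=> h; apply: legr0; have := yw z.2; have := ler_norm z.1; lra.
have legul z : 0 <= z.2 - `|z.1| -> leg_l z = 0.
  by move=> h; apply: legl0; have := yw z.2; have := xN z.1; lra.
exists (fun z => if z.2 - `|z.1| <= 0 then
    if - z.1 - Num.max 0 z.2 <= 0 then gr (leg_r z) else gl (leg_l z)
  else gu (leg_u z)).
  apply: glue_continuous.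
  - apply: glue_continuous.
    + by move=> z; apply: (@continuous_comp _ _ _ leg_r gr);
        [exact: leg_r_continuous|exact: cr].
    + by move=> z; apply: (@continuous_comp _ _ _ leg_l gl);
        [exact: leg_l_continuous|exact: cl].
    + have cf : continuous (fun z : R * R => - z.1 - Num.max 0 z.2).
        move=> z; apply: cvgB; first by apply: cvgN; exact: cvg_fst.
        by apply: pos_part_continuous => ?; exact: cvg_snd.
      move=> z; have [|e] := ge_or_near 0 z cf; first by left.
      by right; rewrite legl0 ?legrl ?e // r0 l0.
  - by move=> z; apply: (@continuous_comp _ _ _ leg_u gu);
      [exact: leg_u_continuous|exact: cu].
  - have cf : continuous (fun z : R * R => z.2 - `|z.1|).
      move=> z; apply: cvgB; first exact: cvg_snd.
      by apply: cvg_norm; exact: cvg_fst.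
    move=> z; have [|e] := ge_or_near 0 z cf; first by left.
    right; rewrite legu0 ?e // legur ?e // legul ?e // u0 r0 l0.
    by case: ifP.
move=> z; case: ifP => [yx|/negbT]; last first.
  by rewrite -ltNge => /ltW yx; constructor 3; rewrite legur // legul.
case: ifP => [lx|/negbT]; first by constructor 1; rewrite legl0 // legu0.
by rewrite -ltNge => /ltW lx; constructor 2; rewrite legrl // legu0.
Qed.

Section Rays.
Variable G : graph.

Definition ray_bound (m : gedge G -> int) (w : seq (step G)) : R :=
  word_norm R m w + `|(word_total m w)%:~R|.

Lemma ray_bound_ge0 m w : 0 <= ray_bound m w.
Proof. by rewrite addr_ge0 // sumr_ge0. Qed.

(** The ray makes N turns around w; neither its compact range nor the error bound grows with N. *)
Lemma loop_ray (v : gvertex G) (w : seq (step G)) (N : nat) : walk v w v ->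
  exists g : R -> graph_space R G,
  [/\ continuous g, g 0 = inl v, forall t, hull v w (g t) &
    forall m, exists l : R -> R,
    [/\ continuous l, l 0 = 0, forall t, theta m (g t) - l t \is a Num.int &
      forall t, 0 <= t -> t <= N%:R ->
        `|l t - (word_total m w)%:~R * t| <= ray_bound m w]].
Proof.
move=> wv; have wNv := walk_pow N wv.
have cs : continuous (fun t : R => (size w)%:R * t).
  by move=> t; apply: cvgM; [exact: cvg_cst|exact: cvg_id].
exists (trace v (word_pow N w) \o (fun t => (size w)%:R * t)); split=> [t||t|m].
- apply: continuous_comp; first exact: cs.
  exact: (trace_continuous wNv).
- by rewrite /= mulr0 (trace_le0 wNv).
- by apply: hull_pow; exact: trace_hull wNv.
exists (word_lift m (word_pow N w) \o (fun t => (size w)%:R * t)).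
split=> [t||t|t t0 tN].
- apply: continuous_comp; first exact: cs.
  exact: word_lift_continuous.
- by rewrite /= mulr0 word_lift_le0.
- exact: theta_trace wNv.
- by have := word_lift_pow m w tN; rewrite max_r.
Qed.

End Rays.

(* Wrapping the tripod around two independent loops. [th b] are two R/Z-valued
   functions on the graph and [lc b] the lifts to R of their pullbacks. *)
Lemma plane_map (G : graph) :
  connected [set: graph_space R G] -> first_betti_number_is G 2 ->
  exists (th : bool -> graph_space R G -> R) (K : set (graph_space R G)) (C : R),
  [/\ forall b p, continuous_modZ (th b) p, compact K
    & forall r : R, exists (c : R * R -> graph_space R G) (lc : bool -> R * R -> R),
    [/\ continuous c, forall b, continuous (lc b), forall z, K (c z),
        forall b z, th b (c z) - lc b z \is a Num.int
      & forall x y e, `|x| <= r -> `|y| <= r ->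
          (forall b, `|lc b (x, y) - lc b (- x, - y)| <= e) ->
          `|x| <= e + C /\ `|y| <= (e + C) + (e + C)]].
Proof.
move=> conn betti.
have [v [wr [wu [ma [mb [d]]]]]] := dual_loops conn betti.
move=> [[walkr walku] d0 [mar mau] [mbr mbu]].
(* The left leg runs backwards along the loop of the right leg: [ma] then measures d (leg_r - leg_l)
   and [mb] measures d leg_u, the two quantities in [leg_spread]. *)
pose wl := rev_word wr; have walkl : walk v wl v by exact: walk_rev.
pose mm (b : bool) := if b then ma else mb.
pose Cb b := ray_bound (mm b) wr + ray_bound (mm b) wl + ray_bound (mm b) wu.
pose C0 := Cb true + Cb false.
have CbC b : Cb b <= C0.
  have Cb0 b' : 0 <= Cb b'.
    by apply: addr_ge0; [apply: addr_ge0|]; exact: ray_bound_ge0.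
  by rewrite /C0; case: b; [rewrite lerDl|rewrite lerDr]; exact: Cb0.
exists (fun b => theta (mm b)), (hull v wr `|` (hull v wl `|` hull v wu)), (C0 + C0).
split=> [b p||r]; first exact: theta_modZ.
  by apply: compactU; [|apply: compactU]; exact: hull_compact.
(* Only the number of turns depends on r; the constant and the compact set are fixed before. *)
pose N := Num.bound r.
have [gr [cr r0 hr /choice[lr lrP]]] := loop_ray N walkr.
have [gl [cl l0 hl /choice[ll llP]]] := loop_ray N walkl.
have [gu [cu u0 hu /choice[lu luP]]] := loop_ray N walku.
have [c cc cP] := tripod_map cr cl cu r0 l0 u0.
pose lc b z := lr (mm b) (leg_r z) + ll (mm b) (leg_l z) + lu (mm b) (leg_u z).
exists c, lc; split=> // [b z|z|b z|].
- have [clr _ _ _] := lrP (mm b); have [cll _ _ _] := llP (mm b).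
  have [clu _ _ _] := luP (mm b); apply: cvgD; first apply: cvgD.
  + by apply: (@continuous_comp _ _ _ leg_r (lr (mm b)));
      [exact: leg_r_continuous|exact: clr].
  + by apply: (@continuous_comp _ _ _ leg_l (ll (mm b)));
      [exact: leg_l_continuous|exact: cll].
  + by apply: (@continuous_comp _ _ _ leg_u (lu (mm b)));
      [exact: leg_u_continuous|exact: clu].
- by case: (cP z) => -[-> _ _]; [left|right; left|right; right].
- have [_ lr0 thr _] := lrP (mm b); have [_ ll0 thl _] := llP (mm b).
  have [_ lu0 thu _] := luP (mm b); rewrite /lc.
  case: (cP z) => -[-> -> ->].
  + by rewrite ll0 lu0 !addr0.
  + by rewrite lr0 lu0 addr0 add0r.
  + by rewrite lr0 ll0 !add0r.
move=> x y e xr yr lce.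
have rN : r <= N%:R by apply: ltW; rewrite archi_boundP // (le_trans _ xr).
have approx b x' y' : `|x'| <= r -> `|y'| <= r ->
    `|lc b (x', y') - ((word_total (mm b) wr)%:~R * leg_r (x', y') +
      (word_total (mm b) wl)%:~R * leg_l (x', y') +
      (word_total (mm b) wu)%:~R * leg_u (x', y'))| <= C0.
  move=> x'r y'r; have [rr rl ru] := @leg_le (x', y') r x'r y'r.
  have [_ _ _ br] := lrP (mm b); have [_ _ _ bl] := llP (mm b).
  have [_ _ _ bu] := luP (mm b).
  have pos (a : R) : 0 <= Num.max 0 a by rewrite le_max lexx.
  have hr' := br _ (pos _) (le_trans rr rN).
  have hl' := bl _ (pos _) (le_trans rl rN).
  have hu' := bu _ (pos _) (le_trans ru rN).
  apply: le_trans (CbC b); rewrite /lc opprD addrACA opprD [X in X + _]addrACA.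
  apply: le_trans (ler_normD _ _) _; apply: lerD hu'.
  by apply: le_trans (ler_normD _ _) _; exact: lerD.
have d1 : 1 <= `|d%:~R : R|.
  by rewrite -intr_norm (_ : 1 = 1%:~R) // ler_int -gtz0_ge1 normr_gt0.
have dle (s : R) : `|d%:~R * s| <= e + (C0 + C0) -> `|s| <= e + (C0 + C0).
  by apply: le_trans; rewrite normrM ler_peMl.
have close b (s s' : R) : `|lc b (x, y) - s| <= C0 -> `|lc b (- x, - y) - s'| <= C0 ->
    `|s - s'| <= e + (C0 + C0).
  move=> h1 h2; rewrite (_ : s - s' = (lc b (x, y) - lc b (- x, - y)) -
    ((lc b (x, y) - s) - (lc b (- x, - y) - s'))); last by ring.
  apply: le_trans (ler_normB _ _) (lerD (lce b) _).
  exact: le_trans (ler_normB _ _) (lerD h1 h2).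
have xNr : `|- x| <= r by rewrite normrN.
have yNr : `|- y| <= r by rewrite normrN.
apply: leg_spread.
  apply: dle; have := close true _ _ (approx true _ _ xr yr) (approx true _ _ xNr yNr).
  rewrite /mm /wl word_total_rev mar mau rmorphN /=.
  by congr (`|_| <= _); ring.
apply: dle; have := close false _ _ (approx false _ _ xr yr) (approx false _ _ xNr yNr).
rewrite /mm /wl word_total_rev mbr mbu rmorphN /=.
by congr (`|_| <= _); ring.
Qed.

End Plane.

(** * Displacement along a homotopy *)

Lemma prod_continuous (T : topologicalType) (I : Type) (U : I -> topologicalType)
    (f : T -> prod_topology U) :
  (forall i, continuous (fun x => f x i)) -> continuous f.
Proof.
move=> cf x; apply/cvg_sup.
move=> i; move: x; apply/(@continuousP _ (initial_topology (@proj I U i))).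
move=> A [B oB <-]; move/continuousP: (cf i); exact.
Qed.

Section Displacement.
Variables (R : realType) (X Z : topologicalType) (H : X * R -> Z) (th : Z -> R).
Variable K : set X.
Hypothesis cK : compact K.
Hypothesis cH : {within [set: X] `*` [set t : R | 0 <= t <= 1], continuous H}.
Hypothesis cth : forall p, continuous_modZ th p.
Local Notation J := ([set: X] `*` [set t : R | 0 <= t <= 1]).

Lemma homotopy_near (x : X) (t : R) : 0 <= t <= 1 -> forall e, 0 < e ->
  \forall p \near (x, t), J p -> exists k : int,
    `|th (H p) - th (H (x, t)) - k%:~R| < e.
Proof.
move=> t01 e e0; have Jxt : J (x, t) by [].
exact: ((subspace_continuousP _ H).1 cH _ Jxt _ (cth (H (x, t)) e0)).
Qed.

Lemma homotopy_slice_modZ (x : X) (t : R) : 0 <= t <= 1 ->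
  continuous_modZ (fun y => th (H (y, t))) x.
Proof.
move=> t01 e e0; have cp : (fun y => (y, t)) y @[y --> x] --> (x, t).
  by apply: (@cvg_pair _ _ _ (nbhs x) (nbhs x) (nbhs t) _ _ _ id (cst t));
    [exact: cvg_id|exact: cvg_cst].
have h : \forall y \near x, J (y, t) -> exists k : int,
    `|th (H (y, t)) - th (H (x, t)) - k%:~R| < e := cp _ (homotopy_near x t01 e0).
by apply: filterS h => y; apply.
Qed.

(** By compactness of K times [0, 1], one time step works for all points of [K]. *)
Lemma homotopy_subdivision : exists2 N : nat, (0 < N)%N &
  forall x, K x -> forall t t' : R, 0 <= t <= 1 -> 0 <= t' <= 1 ->
    `|t' - t| <= N%:R^-1 ->
    exists k : int, `|th (H (x, t')) - th (H (x, t)) - k%:~R| < 4^-1.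
Proof.
have cKJ : compact (K `*` [set t : R | 0 <= t <= 1]).
  apply: compact_setX => //.
  rewrite (_ : [set t | _] = `[0, 1]%classic); first exact: segment_compact.
  by apply/seteqP; split=> t; rewrite /= in_itv.
pose P (d : R) (p : X * R) := forall t', 0 <= p.2 <= 1 -> 0 <= t' <= 1 ->
  `|t' - p.2| < d -> exists k : int, `|th (H (p.1, t')) - th (H p) - k%:~R| < 4^-1.
have [|d d0 dP] := (compact_near_coveringP _).1 cKJ R 0^'+ P _ _; last first.
  have d20 : 0 < d / 2 by rewrite divr_gt0.
  have Pd : K `*` [set t : R | 0 <= t <= 1] `<=` P (d / 2).
    apply: dP => //=; rewrite sub0r normrN gtr0_norm // ltr_pdivrMr //.
    by rewrite ltr_pMr // ltr1n.
  exists (Num.bound (d / 2)^-1).+1 => //.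
  move=> x Kx t t' t01 t01' tt'; apply: (Pd (x, t)) => //.
  apply: le_lt_trans tt' _; rewrite -[ltRHS]invrK ltf_pV2 ?posrE ?invr_gt0 //.
  apply: lt_trans (archi_boundP _) _; last by rewrite ltr_nat.
  by rewrite invr_ge0 ltW.
move=> [x t] [Kx t01].
(* Two values within 1/8 of the one at (x, t) differ by less than 1/4 modulo Z. *)
have e0 : 0 < 8^-1 :> R by rewrite invr_gt0.
have [[A B] /= [Ax Bt] AB] := homotopy_near x t01 e0.
move/nbhs_ballP: Bt => [d /= d0 dB].
exists (A `*` ball t (d / 2), [set s | s < d / 2]) => /=.
  split; last by apply: nbhs_right_lt; rewrite divr_gt0.
  by exists (A, ball t (d / 2)) => //; split=> //; apply: nbhsx_ballx; rewrite divr_gt0.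
move=> [[x' s] d'] /= [[Ax' ts] dd'] s' /= s01 s01' ss'.
have Bs : B s by apply: dB; apply: le_ball ts; rewrite ler_pdivrMr // ler_pMr // ler1n.
have Bs' : B s'.
  apply: dB; rewrite [d]splitr; apply: ball_triangle ts _.
  by rewrite -ball_normE /ball_ /= distrC (lt_trans ss').
have [k1 h1] := AB (x', s) (conj Ax' Bs) (conj I s01).
have [k2 h2] := AB (x', s') (conj Ax' Bs') (conj I s01').
exists (k2 - k1); rewrite intrB.
rewrite (_ : _ - _ = (th (H (x', s')) - th (H (x, t)) - k2%:~R) -
  (th (H (x', s)) - th (H (x, t)) - k1%:~R)); last by ring.
by apply: le_lt_trans (ler_normB _ _) _; lra.
Qed.

(** D adds up the centered increments over N time steps. Each is at most 1 in absolute value, which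
    bounds D everywhere, and is continuous over [K], where the increments are near integers. *)
Lemma homotopy_displacement : exists (D : X -> R) (M : R),
  [/\ forall x, `|D x| <= M,
      forall x, th (H (x, 1)) - th (H (x, 0)) - D x \is a Num.int
    & forall x, K x -> {for x, continuous D}].
Proof.
have [N N0 HN] := homotopy_subdivision.
have NR0 : 0 < N%:R :> R by rewrite ltr0n.
have tN (j : nat) : (j <= N)%N -> 0 <= (j%:R / N%:R : R) <= 1.
  by move=> jN; rewrite divr_ge0 //= ler_pdivrMr // mul1r ler_nat.
pose g (j : nat) x := th (H (x, j%:R / N%:R)).
exists (fun x => \sum_(j < N) centered (g j.+1 x - g j x)), N%:R; split=> [x|x|x Kx].
- apply: le_trans (ler_norm_sum _ _ _) _.
  rewrite -[leRHS](_ : \sum_(j < N) 1 = _); last by rewrite sumr_const card_ord.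
  by apply: ler_sum => j _; exact: centered_le.
- have -> : th (H (x, 1)) - th (H (x, 0)) = \sum_(j < N) (g j.+1 x - g j x).
    rewrite -(big_mkord xpredT (fun j => g j.+1 x - g j x)) telescope_sumr //.
    by rewrite /g divff ?gt_eqF // mul0r.
  by rewrite -sumrB rpred_sum // => j _; exact: centered_int.
suff : forall s : seq 'I_N, {for x, continuous
    (fun x => \sum_(j <- s) centered (g j.+1 x - g j x))} by exact.
elim=> [|j s IHs].
  rewrite (_ : (fun _ => _) = cst 0); first exact: cst_continuous.
  by apply/funext => y; rewrite big_nil.
rewrite (_ : (fun _ => _) = (fun x => centered (g j.+1 x - g j x)) \+
  (fun x => \sum_(j <- s) centered (g j.+1 x - g j x))); last first.
  by apply/funext => y; rewrite big_cons.
apply: cvgD => //.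
apply: (@centered_continuous _ _ (fun x => g j.+1 x - g j x)).
  by apply: continuous_modZB; apply: homotopy_slice_modZ; apply: tN => //; exact: ltnW.
apply: HN => //; [by apply: tN; exact: ltnW|exact: tN|].
by rewrite -mulrBl -natrB // subSnn mul1r ger0_norm // invr_ge0 ltW.
Qed.

End Displacement.

(** * Realizations and piecewise linear maps *)

Lemma weighted_sum_continuous (R : realType) (T : topologicalType) (k : nat)
    (I : Type) (s : seq I) (u : I -> T -> R) (p : I -> 'rV[R]_k) :
  (forall i, continuous (u i)) ->
  continuous (fun c => \sum_(v <- s) u v c *: p v).
Proof.
move=> cu c; elim: s => [|v l IHl].
  rewrite (_ : (fun _ => _) = cst 0); first exact: cst_continuous.
  by apply/funext => y; rewrite big_nil.
rewrite (_ : (fun _ => _) = (fun c => u v c *: p v) \+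
  (fun c => \sum_(v <- l) u v c *: p v)); last first.
  by apply/funext => y; rewrite big_cons.
apply: cvgD; last exact: IHl.
by apply: cvgZr_tmp; exact: cu.
Qed.

Section Realization.
Variables (R : realType) (K : simplicial_complex).

Lemma coords_continuous : continuous (@coords R K).
Proof.
apply/continuousP => O oO; change (realization_open (@coords R K @^-1` O)) => s _.
by exists O.
Qed.

Lemma realization_coord_continuous v :
  continuous (fun x : realization R K => Defs.coord x v).
Proof.
move=> x; apply: (@continuous_comp _ _ _ (@coords R K)
  (@proj (vertex K) (fun _ => R) v)); first exact: coords_continuous.
exact: proj_continuous.
Qed.

Lemma coord_inj (x y : realization R K) :
  (forall v, Defs.coord x v = Defs.coord y v) -> x = y.
Proof. by move=> xy; apply/val_inj/fsfunP. Qed.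

(** Continuity is tested on each closed simplex s, where the sum may be taken over the fixed finite
    set s because the coordinates outside the support are 0. *)
Lemma affine_continuous (k : nat) (p : vertex K -> 'rV[R]_k) :
  continuous (fun x : realization R K =>
    \sum_(v <- finsupp (Defs.coord x)) Defs.coord x v *: p v).
Proof.
apply/continuousP => O oO; move=> s _.
pose g (c : {ptws vertex K -> R}) := \sum_(v <- s) c v *: p v.
have cg : continuous g.
  apply: (@weighted_sum_continuous R {ptws vertex K -> R} k _ s (fun v c => c v)).
  by move=> v; exact: (@proj_continuous (vertex K) (fun _ => R) v).
exists (g @^-1` O); first by move/continuousP: cg; exact.
apply/seteqP; split=> x [xs Ox]; split=> //; move: Ox; rewrite /= /g.
  rewrite [in X in _ -> X](big_fset_incl _ xs) // => v _ vx.
  by rewrite fsfun_dflt // scale0r.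
rewrite (big_fset_incl _ xs) // => v _ vx.
by rewrite fsfun_dflt // scale0r.
Qed.

End Realization.

Lemma piecewise_linear_continuous (R : realType) (K : simplicial_complex) (k : nat)
    (f : realization R K -> 'rV[R]_k) : piecewise_linear f -> continuous f.
Proof.
move=> [K' [phi [h [[_ _ [_ [g [cg _ gK]]]] fh]]]].
have -> : f = (f \o h) \o g by apply/funext => x /=; rewrite gK.
move=> x; apply: continuous_comp; first exact: cg.
rewrite (_ : f \o h = fun x =>
    \sum_(v <- finsupp (Defs.coord x)) Defs.coord x v *: f (phi v)).
  exact: affine_continuous.
by apply/funext => y; exact: fh.
Qed.

(** * The obstruction *)

Lemma small_int_eq0 (R : realType) (x : R) : x \is a Num.int -> `|x| < 1 -> x = 0.
Proof.
move=> /intrP[j ->]; rewrite -intr_norm -[1]/(1%:~R) ltr_int => j1.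
by rewrite (_ : j = 0) //; lia.
Qed.

Lemma equalizer_closed (R : realType) (T : topologicalType) (u v : T -> R) :
  continuous u -> continuous v -> closed [set z | u z = v z].
Proof.
move=> cu cv; have -> : [set z | u z = v z] = (u \- v) @^-1` [set x | x = 0].
  apply/seteqP; split=> z /= [uv]; first by rewrite uv subrr.
  by apply/eqP; rewrite -subr_eq0 uv.
apply: closed_comp => [z _|]; last exact: closed_eq.
by apply: cvgB; [exact: cu|exact: cv].
Qed.

Lemma choice_dep (I : Type) (T : I -> Type) (P : forall i, T i -> Prop) :
  (forall i, exists x, P i x) -> exists f : forall i, T i, forall i, P i (f i).
Proof. by move=> h; exists (fun i => sval (cid (h i))) => i; exact: svalP. Qed.

Section Obstruction.
Variables (R : realType) (n k : nat) (hk : k.+1 = (2 * n)%N).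
Variables (X : 'I_n -> topologicalType) (th : forall i, bool -> X i -> R).
Variables (K : forall i, set (X i)) (C : 'I_n -> R).
Hypothesis cth : forall i b p, continuous_modZ (@th i b) p.
Hypothesis cK : forall i, compact (@K i).
Hypothesis planes : forall i (r : R),
  exists (c : R * R -> X i) (lc : bool -> R * R -> R),
  [/\ continuous c, forall b, continuous (lc b), forall z, K (c z),
      forall b z, th b (c z) - lc b z \is a Num.int
    & forall x y e, `|x| <= r -> `|y| <= r ->
        (forall b, `|lc b (x, y) - lc b (- x, - y)| <= e) ->
        `|x| <= e + C i /\ `|y| <= (e + C i) + (e + C i)].
Variables (Y : topologicalType) (p : prod_topology X -> Y) (q : Y -> prod_topology X).
Variable f : Y -> 'rV[R]_k.
Hypothesis sepY : forall y y' : Y,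
  (forall g : Y -> R, continuous g -> g y = g y') -> y = y'.
Hypotheses (cp : continuous p) (cf : continuous f) (injf : locally_injective f).
Hypothesis hpq : homotopic R (q \o p) idfun.

(** Coordinates 2i and 2i + 1 span the plane of the i-th factor. *)
Let idx (i : 'I_n) (b : bool) : 'I_k.+1 := inord (2 * i + b).

Let idxP (j : 'I_k.+1) : exists i b, j = idx i b.
Proof.
have jn : (j./2 < n)%N by have := ltn_ord j; lia.
exists (Ordinal jn), (odd j); apply: val_inj; rewrite /= inordK.
  by rewrite addnC mul2n odd_double_half.
by rewrite addnC mul2n odd_double_half.
Qed.

Let pair_of (z : 'rV[R]_k.+1) (i : 'I_n) : R * R :=
  (z 0 (idx i false), z 0 (idx i true)).

Let pair_of_continuous i : continuous (pair_of ^~ i).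
Proof.
by move=> z; apply: (@cvg_pair _ _ _ (nbhs z)
  (nbhs (z 0 (idx i false))) (nbhs (z 0 (idx i true))) _ _ _
  (fun z : 'rV[R]_k.+1 => z 0 (idx i false))
  (fun z : 'rV[R]_k.+1 => z 0 (idx i true))); exact: coord_continuous.
Qed.

(* [disp i b] is the displacement in R, along the homotopy from q p to the
   identity, of the (i, b) angle, so that [ang i b] lifts the corresponding
   angle of [q (p (c z))].  Where [p] identifies [c z] and [c (- z)] these lifts
   differ by an integer, and [A] is the set of those z for which they agree. *)
Theorem no_locally_injective_map : False.
Proof.
have [H [cH H0 H1]] := hpq.
have displ (ib : 'I_n * bool) : exists D : prod_topology X -> R, exists M,
    [/\ forall x, `|D x| <= M,
      forall x, th ib.2 (H (x, 1) ib.1) - th ib.2 (H (x, 0) ib.1) - D x \is a Num.int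
    & forall x, (forall i, K (x i)) -> {for x, continuous D}].
  apply: (@homotopy_displacement R (prod_topology X) (X ib.1)
    (fun xt => H xt ib.1) (th ib.2) [set x | forall i, K (x i)]) => //.
  - exact: tychonoff.
  - move=> xt.
    apply: (@continuous_comp (subspace ([set: prod_topology X] `*`
      [set t : R | 0 <= t <= 1])) (prod_topology X) (X ib.1) H (fun x => x ib.1)).
      exact: cH.
    exact: (@proj_continuous 'I_n X ib.1).
have [disp /choice[M dispP]] := choice displ.
(* Where [ang] agrees at z and - z, the values of [lc] differ by at most twice the bound on [disp].
   As [disp] does not involve the planes, their radius r can be chosen after this bound. *)
pose e := \sum_ib (`|M ib| + `|M ib|).
have Me ib : M ib + M ib <= e.
  apply: le_trans (_ : `|M ib| + `|M ib| <= _); first by rewrite lerD ?ler_norm.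
  by rewrite /e (bigD1 ib) //= lerDl sumr_ge0 // => j _; rewrite addr_ge0.
pose r0 := \sum_i `|e + C i|.
have r0i i : `|e + C i| <= r0 by rewrite /r0 (bigD1 i) //= lerDl sumr_ge0.
have r00 : 0 <= r0 by apply: sumr_ge0.
(* Points of [A] have norm at most 2 r0; the extra 1 makes the condition |z| <= r hold automatically
   near [A]. *)
pose r := r0 + r0 + 1.
have [c /choice_dep[lc cP]] := choice_dep (fun i => planes i r).
pose cc z : prod_topology X := fun i => c i (pair_of z i).
have ccc : continuous cc.
  apply: prod_continuous => i z; have [ci _ _ _ _] := cP i.
  by apply: (@continuous_comp _ _ _ (pair_of ^~ i) (c i));
    [exact: pair_of_continuous|exact: ci].
have Kcc z i : K (cc z i) by have [_ _ + _ _] := cP i; apply.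
pose ang i b z := lc i b (pair_of z i) - disp (i, b) (cc z).
have cang i b : continuous (ang i b).
  have [_ clc _ _ _] := cP i; have [_ _ cd] := dispP (i, b).
  have clp : continuous (fun z => lc i b (pair_of z i)).
    by move=> z; apply: (@continuous_comp _ _ _ (pair_of ^~ i) (lc i b));
      [exact: pair_of_continuous|exact: clc].
  have cdc : continuous (fun z => disp (i, b) (cc z)).
    by move=> z; apply: (@continuous_comp _ _ _ cc (disp (i, b))); [exact: ccc|exact: cd].
  by move=> z; exact: (cvgB (clp z) (cdc z)).
have thang i b z : th b (q (p (cc z)) i) - ang i b z \is a Num.int.
  have [_ _ _ ti _] := cP i; have [_ di _] := dispP (i, b).
  have := rpredB (ti b (pair_of z i)) (di (cc z)).
  by rewrite H0 H1 /ang /=; congr (_ \is a Num.int); rewrite /cc; ring.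
have cN : continuous (fun z : 'rV[R]_k.+1 => - z) by move=> z; exact: oppr_continuous.
have ccN : continuous (fun z : 'rV[R]_k.+1 => cc (- z)).
  by move=> z; apply: (@continuous_comp _ _ _ (fun z : 'rV[R]_k.+1 => - z) cc);
    [exact: cN|exact: ccc].
have cpc : continuous (fun z => p (cc z)).
  by move=> z; apply: (@continuous_comp _ _ _ cc p); [exact: ccc|exact: cp].
have cpcN : continuous (fun z : 'rV[R]_k.+1 => p (cc (- z))).
  by move=> z; apply: (@continuous_comp _ _ _ (fun z : 'rV[R]_k.+1 => cc (- z)) p);
    [exact: ccN|exact: cp].
have cangN i b : continuous (fun z : 'rV[R]_k.+1 => ang i b (- z)).
  by move=> z; apply: (@continuous_comp _ _ _ (fun z : 'rV[R]_k.+1 => - z) (ang i b));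
    [exact: cN|exact: cang].
pose A : set 'rV[R]_k.+1 := [set z | [/\ `|z| <= r, p (cc z) = p (cc (- z))
  & forall i b, ang i b z = ang i b (- z)]].
have Ar z : A z -> `|z| < r.
  move=> [zr _ angz]; apply: (@le_lt_trans _ _ (r0 + r0)); last by rewrite ltrDl.
  have zi i : `|z 0 (idx i false)| <= r0 /\ `|z 0 (idx i true)| <= r0 + r0.
    have [_ _ _ _ far] := cP i.
    have pN : pair_of (- z) i = (- z 0 (idx i false), - z 0 (idx i true)).
      by rewrite /pair_of !mxE.
    have [|||x1 x2] := far (z 0 (idx i false)) (z 0 (idx i true)) e.
    - exact: le_trans (row_normW _ _) zr.
    - exact: le_trans (row_normW _ _) zr.
    - move=> b; rewrite -pN.
      have -> : lc i b (z 0 (idx i false), z 0 (idx i true)) - lc i b (pair_of (- z) i)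
          = disp (i, b) (cc z) - disp (i, b) (cc (- z)).
        by have := angz i b; rewrite /ang /pair_of; lra.
      apply: le_trans (Me (i, b)); apply: le_trans (ler_normB _ _) _.
      by have [dM _ _] := dispP (i, b); rewrite lerD.
    have eC : e + C i <= r0 := le_trans (ler_norm _) (r0i i).
    by split; [exact: le_trans eC|apply: le_trans x2 _; exact: lerD].
  rewrite -(ger0_norm (addr_ge0 r00 r00)); apply/ler_addgt0Pr => d d0.
  apply/ltW/row_norm_ltP; first by rewrite ltr_wpDl.
  move=> j; have [i [b ->]] := idxP j; have [z1 z2] := zi i.
  rewrite (ger0_norm (addr_ge0 r00 r00)).
  by case: b; [apply: le_lt_trans z2 _|apply: le_lt_trans z1 _]; lra.
pose F (z : 'rV[R]_k.+1) := f (p (cc z)) - f (p (cc (- z))).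
have cfpc : continuous (fun z => f (p (cc z))).
  by move=> z; apply: (@continuous_comp _ _ _ (fun z => p (cc z)) f);
    [exact: cpc|exact: cf].
have cfpcN : continuous (fun z : 'rV[R]_k.+1 => f (p (cc (- z)))).
  by move=> z; apply: (@continuous_comp _ _ _ (fun z : 'rV[R]_k.+1 => p (cc (- z))) f);
    [exact: cpcN|exact: cf].
apply: (@odd_map_zero_set R k F A).
- by move=> z; exact: (cvgB (cfpc z) (cfpcN z)).
- by move=> z; rewrite /F opprK opprB.
- apply: bounded_closed_compact.
    exists r; split; first exact: num_real.
    by move=> x rx z [zr _ _]; exact: le_trans zr (ltW rx).
  (* As real functions separate the points of [Y], the equality in [Y] becomes an intersection of
     closed conditions. *)
  have -> : A = [set z | `|z| <= r] `&`
      ((\bigcap_(g in [set g : Y -> R | continuous g])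
         [set z | g (p (cc z)) = g (p (cc (- z)))]) `&`
       (\bigcap_(ib in [set: 'I_n * bool])
         [set z | ang ib.1 ib.2 z = ang ib.1 ib.2 (- z)])).
    apply/seteqP; split=> z.
      move=> [zr pz az]; split=> //; split=> [g _ /=|[i b] _ /=]; last exact: az.
      by rewrite pz.
    move=> [zr [gz az]]; split=> // [|i b]; last exact: (az (i, b) I).
    by apply: sepY => g cg; exact: gz.
  apply: closedI.
    have -> : [set z : 'rV[R]_k.+1 | `|z| <= r] = (fun z => `|z|) @^-1` [set x | x <= r].
      by [].
    by apply: closed_comp => [z _|]; [exact: norm_continuous|exact: closed_le].
  apply: closedI; apply: closed_bigI.
    move=> g cg; apply: equalizer_closed => z.
      by apply: (@continuous_comp _ _ _ (fun z => p (cc z)) g); [exact: cpc|exact: cg].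
    by apply: (@continuous_comp _ _ _ (fun z : 'rV[R]_k.+1 => p (cc (- z))) g);
      [exact: cpcN|exact: cg].
  by move=> [i b] _; exact: (equalizer_closed (cang i b) (cangN i b)).
- split; rewrite ?oppr0 ?normr0 //.
  by rewrite /r -addrA addr_ge0 // addr_ge0.
- by move=> z [zr pz az]; split; rewrite ?normrN ?opprK.
(* Near a, local injectivity of f at the common image turns a zero of F into an equality in [Y]; the
   lifts at z and - z then differ by integers of absolute value below 1. *)
move=> a Aa; have [_ pa aa] := Aa.
have [S Sa injS] := injf (p (cc a)).
have h1 : \forall z \near a, S (p (cc z)) by exact: cpc.
have h2 : \forall z \near a, S (p (cc (- z))) by apply: cpcN; rewrite /= -pa.
have h3 : \forall z \near a, `|z| < r.
  by apply: (cvgr_lt _ (@norm_continuous _ _ a)); exact: Ar.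
have h4 : \forall z \near a, forall ib : 'I_n * bool,
    `|ang ib.1 ib.2 z - ang ib.1 ib.2 (- z)| < 1.
  apply: (@filter_forall _ ('I_n * bool)%type (fun ib z =>
    `|ang ib.1 ib.2 z - ang ib.1 ib.2 (- z)| < 1) (nbhs a)) => -[i b] /=.
  have h : ang i b z - ang i b (- z) @[z --> a] --> ang i b a - ang i b (- a).
    exact: (cvgB (cang i b a) (cangN i b a)).
  move: h; rewrite -aa subrr => h.
  have {}h : \forall z \near a, `|0 - (ang i b z - ang i b (- z))| < 1.
    exact: ((cvgrPdist_lt _ _).1 h _ ltr01).
  by apply: filterS h => z /=; rewrite sub0r normrN.
near=> z => Fz.
have S1 : S (p (cc z)) by near: z.
have S2 : S (p (cc (- z))) by near: z.
have zr : `|z| < r by near: z.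
have zang : forall ib : 'I_n * bool, `|ang ib.1 ib.2 z - ang ib.1 ib.2 (- z)| < 1.
  by near: z.
have pz : p (cc z) = p (cc (- z)).
  apply: injS; [exact: mem_set|exact: mem_set|].
  by apply/eqP; rewrite -subr_eq0; apply/eqP.
split=> //; first exact: ltW.
move=> i b; apply/eqP; rewrite -subr_eq0; apply/eqP/small_int_eq0;
  last exact: (zang (i, b)).
have := rpredB (thang i b (- z)) (thang i b z); rewrite pz.
by congr (_ \is a Num.int); ring.
Unshelve. all: by end_near. Qed.

End Obstruction.

Local Close Scope ring_scope.
Local Close Scope classical_set_scope.

Theorem corollary3 (R : realType) (n : nat) (hn : (1 <= n)%N)
    (G : 'I_n -> graph)
    (hconn : forall i : 'I_n, connected [set: graph_space R (G i)]%classic)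
    (hbetti : forall i : 'I_n, first_betti_number_is (G i) 2) :
  ~ immerses_up_to_homotopy R
      (prod_topology (fun i : 'I_n => graph_space R (G i))) (2 * n - 1)%N.
Proof.
move=> [Y [[p [q [cp _ hqp _]]] [_ [f [plf injf]]]]].
(* The subtraction is truncated, so n >= 1 matters. *)
have hk : (2 * n - 1).+1 = (2 * n)%N by lia.
have [th /choice_dep[K /choice_dep[C thKC]]] :=
  choice_dep (fun i => plane_map (hconn i) (hbetti i)).
apply: (@no_locally_injective_map R n (2 * n - 1) hk
  (fun i => graph_space R (G i)) th K C _ _ _ (realization R Y) p q f) => //.
- by move=> i; have [] := thKC i.
- by move=> i; have [] := thKC i.
- by move=> i; have [] := thKC i.
- by move=> y y' yy'; apply: coord_inj => v;
    apply: (yy' (fun x => Defs.coord x v)); exact: realization_coord_continuous.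
- exact: piecewise_linear_continuous.
Qed.
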